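(* The class of diagram groups is closed under countable direct products: if $G_1,G_2,\ldots$ is a countable family of diagram groups, then their direct product (in the restricted sense) is a diagram group.
   Context: Here ''direct product'' of a family of groups means the restricted direct product (elements with finitely many nontrivial coordinates), i.e. the free product of the groups factored by the relations saying that elements of different factors commute (the graph product over a complete graph). A directed $2$-complex $\mathcal{K}$ consists of: a directed graph; a set of $2$-cells; for each $2$-cell $f$, two nonempty directed paths $\lceil f\rceil$ (top) and $\lfloor f\rfloor$ (bottom) in the graph with the same initial vertex and the same terminal vertex; and a fixed-point-free involution $f\mapsto f^{-1}$ on $2$-cells with $\lceil f^{-1}\rceil=\lfloor f\rfloor$, $\lfloor f^{-1}\rfloor=\lceil f\rceil$. A $1$-path is a (possibly empty) directed path in the graph. The Squier complex $\mathrm{Sq}(\mathcal{K})$ is the $2$-dimensional cell complex whose vertices are the nonempty $1$-paths; whose edges are the triples $(p,f,q)$, with $p,q$ $1$-paths and $f$ a $2$-cell such that $p\lceil f\rceil q$ is a $1$-path, going from $p\lceil f\rceil q$ to $p\lfloor f\rfloor q$, with $(p,f,q)^{-1}=(p,f^{-1},q)$; and which has, for every $(p,f,q,g,r)$ with $f,g$ $2$-cells and $p\lceil f\rceil q\lceil g\rceil r$ a $1$-path, a $2$-cell attached along the loop $(p,f,q\lceil g\rceil r)\,(p\lfloor f\rfloor q,g,r)\,(p,f,q\lfloor g\rfloor r)^{-1}\,(p\lceil f\rceil q,g,r)^{-1}$. For a nonempty $1$-path $w$, $\mathcal{D}(\mathcal{K},w)=\pi_1(\mathrm{Sq}(\mathcal{K}),w)$;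 a diagram group is a group isomorphic to some $\mathcal{D}(\mathcal{K},w)$. *)

(* Defs.v *)
From Stdlib Require Import Relation_Operators.
From HB Require Import structures.
From mathcomp Require Import all_boot generic_quotient.
From mathcomp Require Import boolp classical_sets cardinality.

Set Implicit Arguments.
Unset Strict Implicit.
Unset Printing Implicit Defensive.

Local Open Scope classical_set_scope.
Local Open Scope group_scope.
Local Open Scope quotient_scope.

Record digraph := Digraph {
  vertex : Type;
  arrow : Type;
  source : arrow -> vertex;
  target : arrow -> vertex
}.

Section Walks.
Variable D : digraph.

Fixpoint walk (x : vertex D) (s : seq (arrow D)) (y : vertex D) : Prop :=
  if s is e :: s' then source e = x /\ walk (target e) s' y else x = y.

(* A directed path is represented by its sequence of arrows.  The empty
   sequence thus stands for the empty path at any vertex; wherever an empty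
   path is used below, its vertex is forced by the nonempty path of which it
   is a factor. *)
Definition is_1path (s : seq (arrow D)) : Prop := exists x y, walk x s y.

Lemma walk_cat s t x y :
  walk x (s ++ t) y <-> exists2 z, walk x s z & walk z t y.
Proof.
elim: s x => [|e s IH] x /=; first by split=> [w|[z ->]//]; exists x.
split=> [[<- /IH [z ws wt]]|[z [<- ws] wt]]; first by exists z.
by split=> //; apply/IH; exists z.
Qed.

Lemma walk_inj s x y x' y' : s <> [::] ->
  walk x s y -> walk x' s y' -> x = x' /\ y = y'.
Proof.
case: s => // e s _ /= [<- ws] [<- ws']; split=> //.
elim: s e ws ws' => [|e' s IH] e /=; first by move=> <- <-.
by move=> [_ ws] [_ ws']; apply: IH ws ws'.
Qed.

End Walks.

(** * Combinatorial 2-complexes and their fundamental groups *)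

(* The arrows are the oriented edges, so that each geometric edge gives two
   arrows, exchanged by [einv]; [bd c] is the loop along which the 2-cell [c]
   is attached. *)
Record cell_complex := CellComplex {
  skeleton :> digraph;
  einv : arrow skeleton -> arrow skeleton;
  einvK : involutive einv;
  einv_neq : forall e, einv e <> e;
  source_einv : forall e, source (einv e) = target e;
  cell : Type;
  bd : cell -> seq (arrow skeleton);
  bd_loop : forall c, exists x, walk x (bd c) x
}.

Section FundamentalGroup.
Variables (X : cell_complex) (x : vertex X).

Record loop := Loop { loop_seq :> seq (arrow X); loopP : walk x loop_seq x }.

HB.instance Definition _ := gen_eqMixin loop.
HB.instance Definition _ := gen_choiceMixin loop.

(* The edge-path group: loops up to insertion and deletion of backtracks and
   of boundary loops of 2-cells.  The closure is taken on [loop], so that every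
   intermediate sequence is a loop at [x].  Insertions of the inverse or of a
   cyclic shift of a boundary loop need not be listed, being consequences. *)
Inductive elementary : seq (arrow X) -> seq (arrow X) -> Prop :=
| elementary_inv p e q : elementary (p ++ [:: e; einv e] ++ q) (p ++ q)
| elementary_bd p c q : elementary (p ++ bd c ++ q) (p ++ q).

Definition homotopic : loop -> loop -> Prop :=
  clos_refl_sym_trans loop (fun l l' => elementary l l').

Definition homotopicb (l l' : loop) : bool := `[< homotopic l l' >].

Lemma homotopicb_refl : reflexive homotopicb.
Proof. by move=> l; apply/asboolP; apply: rst_refl. Qed.

Lemma homotopicb_sym : symmetric homotopicb.
Proof. by move=> l l'; apply/asboolP/asboolP; apply: rst_sym. Qed.

Lemma homotopicb_trans : transitive homotopicb.
Proof.
by move=> l' l l'' /asboolP h /asboolP h'; apply/asboolP; apply: rst_trans h h'.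
Qed.

Canonical homotopicb_equiv :=
  EquivRel homotopicb homotopicb_refl homotopicb_sym homotopicb_trans.

Definition pi1 := {eq_quot homotopicb}.
HB.instance Definition _ := Choice.on pi1.
HB.instance Definition _ := EqQuotient.on pi1.

Lemma pi1P (l l' : loop) : \pi_pi1 l = \pi_pi1 l' <-> homotopic l l'.
Proof. by split=> [/eqmodP/asboolP|h] //; apply/eqmodP/asboolP. Qed.

Lemma loop_inj (l l' : loop) : loop_seq l = loop_seq l' -> l = l'.
Proof.
case: l l' => s ws [s' ws'] /= E; case: _ / E in ws' *.
by rewrite (Prop_irrelevance ws ws').
Qed.

Definition loop1 : loop := @Loop [::] erefl.

Lemma loop_mul_subproof (l l' : loop) : walk x (l ++ l') x.
Proof. by apply/walk_cat; exists x; apply: loopP. Qed.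
Definition loop_mul (l l' : loop) : loop := Loop (loop_mul_subproof l l').

Lemma target_einv e : target (einv e) = source e :> vertex X.
Proof. by rewrite -source_einv einvK. Qed.

Lemma walk_inv y s z : walk y s z -> walk z (map (@einv X) (rev s)) y.
Proof.
elim: s y => [|e s IH] y /=; first by move=> ->.
case=> <- /IH ws; rewrite rev_cons map_rcons -cats1; apply/walk_cat.
by exists (target e) => //=; rewrite source_einv target_einv.
Qed.

Definition loop_inv (l : loop) : loop := Loop (walk_inv (loopP l)).

Lemma homotopic_mul (l1 l1' l2 l2' : loop) :
  homotopic l1 l1' -> homotopic l2 l2' ->
  homotopic (loop_mul l1 l2) (loop_mul l1' l2').
Proof.
move=> h1 h2; apply: (@rst_trans _ _ _ (loop_mul l1' l2)).
  elim: h1 => [l l' s|l|l l' _|l l' l'' _ h _ h'].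
  - apply: rst_step; rewrite /=; case: s => [p e q|p c q].
      by rewrite -!catA; exact: (elementary_inv p e (q ++ l2)).
    by rewrite -!catA; exact: (elementary_bd p c (q ++ l2)).
  - exact: rst_refl.
  - exact: rst_sym.
  - exact: rst_trans h h'.
elim: h2 => [l l' s|l|l l' _|l l' l'' _ h _ h'].
- apply: rst_step; rewrite /=; case: s => [p e q|p c q].
    by rewrite !(catA l1' p); exact: elementary_inv.
  by rewrite !(catA l1' p); exact: elementary_bd.
- exact: rst_refl.
- exact: rst_sym.
- exact: rst_trans h h'.
Qed.

Lemma homotopic_mulV (l : loop) : homotopic (loop_mul l (loop_inv l)) loop1.
Proof.
have cancel (s t : seq (arrow X)) (l1 l2 : loop) :
    loop_seq l1 = s ++ map (@einv X) (rev s) -> loop_seq l2 = [::] ->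
    homotopic l1 l2.
  elim/last_ind: s l1 l2 => [|s e IH] l1 l2 e1 e2.
    by rewrite (@loop_inj l1 l2) ?e1 ?e2 //; apply: rst_refl.
  move: e1; rewrite rev_rcons /= cat_rcons => e1.
  have w : walk x (s ++ map (@einv X) (rev s)) x.
    have := loopP l1; rewrite e1 => /walk_cat[z ws /= [ez]].
    rewrite source_einv => -[_]; rewrite target_einv ez => wr.
    by apply/walk_cat; exists z.
  apply: (@rst_trans _ _ _ (Loop w)); last exact: IH.
  by apply: rst_step; rewrite /= e1; exact: (elementary_inv s e).
exact: (cancel l [::]).
Qed.

Lemma loop_invK (l : loop) : loop_inv (loop_inv l) = l.
Proof.
apply: loop_inj => /=.
by rewrite -map_rev revK mapK //; apply: einvK.
Qed.

Lemma homotopic_mulVl (l : loop) : homotopic (loop_mul (loop_inv l) l) loop1.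
Proof. by have := homotopic_mulV (loop_inv l); rewrite loop_invK. Qed.

(* Loops are multiplied by concatenation, the left factor first. *)
Definition pi1_mul (a b : pi1) : pi1 := \pi_pi1 (loop_mul (repr a) (repr b)).
Definition pi1_one : pi1 := \pi_pi1 loop1.
Definition pi1_inv (a : pi1) : pi1 := \pi_pi1 (loop_inv (repr a)).

Lemma pi1_mulE (l l' : loop) :
  pi1_mul (\pi_pi1 l) (\pi_pi1 l') = \pi_pi1 (loop_mul l l').
Proof. by apply/pi1P; apply: homotopic_mul; apply/pi1P; rewrite reprK. Qed.

Lemma pi1_mulA : associative pi1_mul.
Proof.
move=> a b c; rewrite -[a]reprK -[b]reprK -[c]reprK !pi1_mulE.
by congr (\pi_pi1 _); apply: loop_inj; rewrite /= !reprK catA.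
Qed.

Lemma pi1_mul1 : left_id pi1_one pi1_mul.
Proof.
move=> a; rewrite -[a]reprK /pi1_one pi1_mulE; congr (\pi_pi1 _).
exact: loop_inj.
Qed.

Lemma pi1_mulr1 : right_id pi1_one pi1_mul.
Proof.
move=> a; rewrite -[a]reprK /pi1_one pi1_mulE; congr (\pi_pi1 _).
by apply: loop_inj; rewrite /= cats0.
Qed.

Lemma pi1_mulV : left_inverse pi1_one pi1_inv pi1_mul.
Proof.
move=> a; rewrite -{2}[a]reprK pi1_mulE; apply/pi1P; exact: homotopic_mulVl.
Qed.

Lemma pi1_mulrV : right_inverse pi1_one pi1_inv pi1_mul.
Proof.
move=> a; rewrite -{1}[a]reprK pi1_mulE; apply/pi1P; exact: homotopic_mulV.
Qed.

HB.instance Definition _ :=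
  isGroup.Build pi1 pi1_mulA pi1_mul1 pi1_mulr1 pi1_mulV pi1_mulrV.

End FundamentalGroup.

(** * Directed 2-complexes and diagram groups *)

Record directed_2complex := Directed2Complex {
  graph2 :> digraph;
  cell2 : Type;
  top : cell2 -> seq (arrow graph2);
  bot : cell2 -> seq (arrow graph2);
  inv2 : cell2 -> cell2;
  top_neq0 : forall f, top f <> [::];
  bot_neq0 : forall f, bot f <> [::];
  top_bot_parallel : forall f, exists x y, walk x (top f) y /\ walk x (bot f) y;
  inv2K : involutive inv2;
  inv2_neq : forall f, inv2 f <> f;
  top_inv2 : forall f, top (inv2 f) = bot f;
  bot_inv2 : forall f, bot (inv2 f) = top f
}.

Section Squier.
Variable K : directed_2complex.

Record sq_vertex := SqVertex {
  sqv_path :> seq (arrow K);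
  sqv_neq0 : sqv_path <> [::];
  sqv_1path : is_1path sqv_path
}.

Record sq_edge := SqEdge {
  sqe_left : seq (arrow K);
  sqe_cell : cell2 K;
  sqe_right : seq (arrow K);
  sqe_1path : is_1path (sqe_left ++ top sqe_cell ++ sqe_right)
}.

Record sq_cell := SqCell {
  sqc_p : seq (arrow K);
  sqc_f : cell2 K;
  sqc_q : seq (arrow K);
  sqc_g : cell2 K;
  sqc_r : seq (arrow K);
  sqc_1path : is_1path (sqc_p ++ top sqc_f ++ sqc_q ++ top sqc_g ++ sqc_r)
}.

Lemma sq_vertex_inj (u v : sq_vertex) : sqv_path u = sqv_path v -> u = v.
Proof.
case: u v => s h h' [t k k'] /= E; case: _ / E in k k' *.
by rewrite (Prop_irrelevance h k) (Prop_irrelevance h' k').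
Qed.

Lemma sq_edge_eq (d e : sq_edge) : sqe_left d = sqe_left e ->
  sqe_cell d = sqe_cell e -> sqe_right d = sqe_right e -> d = e.
Proof.
case: d e => p f q h [p' f' q' h'] /= Ep Ef Eq.
case: _ / Ep in h' *; case: _ / Ef in h' *; case: _ / Eq in h' *.
by rewrite (Prop_irrelevance h h').
Qed.

Lemma is_1path_bot p (f : cell2 K) q :
  is_1path (p ++ top f ++ q) -> is_1path (p ++ bot f ++ q).
Proof.
move=> [x [y /walk_cat[z wp /walk_cat[t wf wq]]]].
have [u [v [wt wb]]] := top_bot_parallel f.
have [Ez Et] := walk_inj (@top_neq0 K f) wf wt.
exists x, y; apply/walk_cat; exists z => //.
by apply/walk_cat; exists t => //; rewrite Ez Et.
Qed.

Lemma cat_mid_neq0 (T : Type) (p s q : seq T) :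
  s <> [::] -> p ++ s ++ q <> [::].
Proof. by case: p => //; case: s. Qed.

Definition sq_source (e : sq_edge) : sq_vertex :=
  SqVertex (cat_mid_neq0 (@top_neq0 K (sqe_cell e))) (sqe_1path e).

Definition sq_target (e : sq_edge) : sq_vertex :=
  SqVertex (cat_mid_neq0 (@bot_neq0 K (sqe_cell e)))
           (is_1path_bot (sqe_1path e)).

Definition sq_graph : digraph := Digraph sq_source sq_target.

Lemma sq_inv_subproof (e : sq_edge) :
  is_1path (sqe_left e ++ top (inv2 (sqe_cell e)) ++ sqe_right e).
Proof. by rewrite top_inv2; apply: is_1path_bot; apply: sqe_1path. Qed.

Definition sq_inv (e : sq_edge) : sq_edge := SqEdge (sq_inv_subproof e).

Lemma sq_invK : involutive sq_inv.
Proof. by move=> e; apply: sq_edge_eq => //=; apply: inv2K. Qed.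

Lemma sq_inv_neq e : sq_inv e <> e.
Proof. by move=> /(congr1 sqe_cell); apply: inv2_neq. Qed.

Lemma sq_source_inv (e : arrow sq_graph) :
  @source sq_graph (sq_inv e) = target e.
Proof. by apply: sq_vertex_inj; rewrite /= top_inv2. Qed.

Section Boundary.
Variable c : sq_cell.
Let p := sqc_p c.
Let f := sqc_f c.
Let q := sqc_q c.
Let g := sqc_g c.
Let r := sqc_r c.

Lemma sq_edge1_subproof : is_1path (p ++ top f ++ (q ++ top g ++ r)).
Proof. exact: sqc_1path c. Qed.

Lemma sq_edge2_subproof : is_1path ((p ++ bot f ++ q) ++ top g ++ r).
Proof.
by rewrite -!catA; apply: is_1path_bot; exact: sq_edge1_subproof.
Qed.

Lemma sq_edge4_subproof : is_1path ((p ++ top f ++ q) ++ top g ++ r).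
Proof. by rewrite -!catA; exact: sq_edge1_subproof. Qed.

Lemma sq_edge3_subproof : is_1path (p ++ top f ++ (q ++ bot g ++ r)).
Proof. by have := is_1path_bot sq_edge4_subproof; rewrite -!catA. Qed.

Definition sq_bd : seq sq_edge :=
  [:: SqEdge sq_edge1_subproof;
      SqEdge sq_edge2_subproof;
      sq_inv (SqEdge sq_edge3_subproof);
      sq_inv (SqEdge sq_edge4_subproof)].

Lemma sq_bd_loop : exists x, @walk sq_graph x sq_bd x.
Proof.
exists (sq_source (SqEdge sq_edge1_subproof)); rewrite /=.
by do !split; apply: sq_vertex_inj; rewrite /= ?top_inv2 ?bot_inv2 -?catA.
Qed.

End Boundary.

Definition Sq : cell_complex :=
  @CellComplex sq_graph sq_inv sq_invK sq_inv_neq sq_source_inv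
               sq_cell sq_bd sq_bd_loop.

Definition Dgroup (w : sq_vertex) : groupType := @pi1 Sq w.

End Squier.

Definition isomorphic (G H : groupType) : Prop :=
  exists f : {multiplicative G -> H}, bijective f.

Definition diagram_group (G : groupType) : Prop :=
  exists (K : directed_2complex) (w : sq_vertex K), isomorphic G (Dgroup w).

(** * Restricted direct products *)

Section RestrictedProduct.
Variables (I : Type) (G : I -> groupType).

Definition fin_supp (u : forall i, G i) : bool :=
  `[< finite_set [set i | u i <> 1] >].

Record restricted_prod := RestrictedProd {
  rp_val :> forall i, G i;
  rp_fin : fin_supp rp_val
}.

HB.instance Definition _ := [isSub for rp_val].
HB.instance Definition _ := [Choice of restricted_prod by <:].

Implicit Types u v t : restricted_prod.

Lemma rp_eq u v : (forall i, u i = v i) -> u = v.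
Proof. by move=> uv; apply: val_inj; apply: functional_extensionality_dep. Qed.

Lemma rp_one_subproof : fin_supp (fun i => 1).
Proof.
apply/asboolP; apply: sub_finite_set (finite_set0 I) => i /=.
by case.
Qed.
Definition rp_one := RestrictedProd rp_one_subproof.

Lemma rp_mul_subproof u v : fin_supp (fun i => u i * v i).
Proof.
have /asboolP fu := rp_fin u; have /asboolP fv := rp_fin v.
have fuv : finite_set ([set i | u i <> 1] `|` [set i | v i <> 1]).
  by rewrite finite_setU.
apply/asboolP; apply: sub_finite_set fuv => i /= uv.
case: (pselect (u i = 1)) => [ui|]; last by left.
by right=> vi; apply: uv; rewrite ui vi mulg1.
Qed.
Definition rp_mul u v := RestrictedProd (rp_mul_subproof u v).

Lemma rp_inv_subproof u : fin_supp (fun i => (u i)^-1).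
Proof.
have /asboolP fu := rp_fin u.
apply/asboolP; apply: sub_finite_set fu => i /= ui ui1.
by apply: ui; rewrite ui1 invg1.
Qed.
Definition rp_inv u := RestrictedProd (rp_inv_subproof u).

Lemma rp_mulA : associative rp_mul.
Proof. by move=> u v t; apply: rp_eq => i; apply: mulgA. Qed.
Lemma rp_mul1 : left_id rp_one rp_mul.
Proof. by move=> u; apply: rp_eq => i; apply: mul1g. Qed.
Lemma rp_mulr1 : right_id rp_one rp_mul.
Proof. by move=> u; apply: rp_eq => i; apply: mulg1. Qed.
Lemma rp_mulV : left_inverse rp_one rp_inv rp_mul.
Proof. by move=> u; apply: rp_eq => i; apply: mulVg. Qed.
Lemma rp_mulrV : right_inverse rp_one rp_inv rp_mul.
Proof. by move=> u; apply: rp_eq => i; apply: mulgV. Qed.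

HB.instance Definition _ :=
  isGroup.Build restricted_prod rp_mulA rp_mul1 rp_mulr1 rp_mulV rp_mulrV.

End RestrictedProduct.

(* Main.v *)
(* Let the diagram group of [K i] at [w i] be [G i].  Over the disjoint union of
   the letters of the [K i], add letters [Mark i] and [Tail n], and 2-cells
   [Tail n = Mark i w_i Tail (n+1)], where [i] is the index of code [n] (if
   there is no such index, [Tail n = Tail (n+1)]).  The words reachable from
   [Tail 0] are [Mark i_1 u_1 ... Mark i_k u_k Tail n], with one block for each
   index of code less than [n] and [u_j] homotopic to [w_(i_j)]; the markers
   ensure that a block is folded only when it equals [w_i].  The component of
   [Tail 0] is thus a telescope of finite products of components of the Squier
   complexes of the [K i], whose fundamental group is the restricted product. *)
From Stdlib Require Import Relation_Operators.
From HB Require Import structures.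
Require Import Defs.
From mathcomp Require Import all_boot generic_quotient.
From mathcomp Require Import boolp classical_sets cardinality.

Set Implicit Arguments.
Unset Strict Implicit.
Unset Printing Implicit Defensive.

Local Open Scope group_scope.
Local Open Scope quotient_scope.

(** * Factorizations of words around a distinguished letter *)

Section Words.
Variables (T : Type) (P : pred T).
Implicit Types (x : T) (s t : seq T).

(** On each side the displayed [x] is the last letter violating [P], so the two occurrences sit at
    the same place. *)
Lemma cat_pivotr s x s' t t' : ~~ P x -> all P s' -> all P t' ->
  s ++ x :: s' = t ++ x :: t' -> s = t /\ s' = t'.
Proof.
move=> Px; elim: s t => [|y s IH] [|z t] /= Ps' Pt'.
- by case.
- by case=> _ Es'; move: Ps'; rewrite Es' all_cat /= (negPf Px) andbF.
- by case=> _ Et'; move: Pt'; rewrite -Et' all_cat /= (negPf Px) andbF.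
- by case=> -> /IH [] // -> ->.
Qed.

Lemma cat_pivot_last s x t y t' : ~~ P y -> all P s ->
  s ++ [:: x] = t ++ y :: t' -> [/\ s = t, x = y & t' = [::]].
Proof.
move=> Py; elim: s t => [|z s IH] [|z' t] //=.
- by move=> _ [-> <-].
- by move=> _ [_]; case: t.
- by move=> /andP[Pz _] [Ez _]; rewrite Ez (negPf Py) in Pz.
- by move=> /andP[_ Ps] [-> /(IH _ Ps) [-> -> ->]].
Qed.

(** The nonempty factor [t] satisfies [P] throughout and so cannot cover [x]: it lies entirely after
    or entirely before it. This locates the factor rewritten by a 2-cell with respect to a
    marker. *)
Lemma cat_factor s x r p t q : all P s -> all P t -> t <> [::] -> ~~ P x ->
  s ++ x :: r = p ++ t ++ q ->
  (exists2 p', p = s ++ x :: p' & r = p' ++ t ++ q) \/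
  (exists2 q', s = p ++ t ++ q' & q = q' ++ x :: r).
Proof.
move=> + Pt t0 Px; elim: p s => [|y p IH] /= s Ps.
  move=> E; right; elim: t s Ps Pt E {t0} => [|z t IHt] s Ps /=.
    by move=> _ <-; exists s.
  move=> /andP[Pz Pt]; case: s Ps => [|y s] /=.
    by move=> _ [Ez _]; rewrite -Ez (negPf Px) in Pz.
  move=> /andP[_ Ps] [-> /(IHt _ Ps Pt)] [q' -> ->].
  by exists q'.
case: s Ps => [|z s] /= Ps [-> E]; first by left; exists p.
have /andP[_ {}Ps] := Ps.
by case: (IH _ Ps E) => [][q' -> ->]; [left|right]; exists q'.
Qed.

End Words.

Lemma map_eq_cat (S T : Type) (f : S -> T) s p q : map f s = p ++ q ->
  exists s1 s2, [/\ s = s1 ++ s2, map f s1 = p & map f s2 = q].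
Proof.
move=> E; exists (take (size p) s), (drop (size p) s).
by rewrite cat_take_drop !(map_take, map_drop) E take_size_cat // drop_size_cat.
Qed.

(** * Homotopy in Squier complexes *)

Section SquierPaths.
Variable K : directed_2complex.
Implicit Types (e : sq_edge K) (s t r : seq (sq_edge K)).
Implicit Types (x y z p q : seq (arrow K)).

(* The 1-skeleton of [Sq K] without the proofs carried by its vertices. *)
Definition word_graph : digraph :=
  @Digraph (seq (arrow K)) (sq_edge K)
    (fun e => sq_source e) (fun e => sq_target e).

Local Notation sqwalk := (@walk word_graph).

Lemma sqwalkP (u v : sq_vertex K) s :
  @walk (sq_graph K) u s v <-> sqwalk u s v.
Proof.
elim: s u => [|e s IH] u /=; first by split=> [->//|/sq_vertex_inj].
by have [wv vw] := IH (sq_target e);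
  split=> -[E ?]; split; [rewrite -E|exact: wv|exact: sq_vertex_inj|exact: vw].
Qed.

Lemma sqwalk_cat s t x y z : sqwalk x s y -> sqwalk y t z -> sqwalk x (s ++ t) z.
Proof. by move=> ws wt; apply/walk_cat; exists y. Qed.

Definition sqrev s := map (@sq_inv K) (rev s).

Lemma sqwalk_rev s x y : sqwalk x s y -> sqwalk y (sqrev s) x.
Proof.
rewrite /sqrev; elim: s x => [|e s IH] x /=; first by move->.
case=> <- /IH ws; rewrite rev_cons map_rcons -cats1; apply: sqwalk_cat ws _.
by rewrite /= top_inv2 bot_inv2.
Qed.

Lemma sqwalk_bd (c : sq_cell K) x y : sqwalk x (sq_bd c) y ->
  x = sq_source (SqEdge (sq_edge1_subproof c)) /\ y = x.
Proof.
by case=> <- [_ [_ [_ /= <-]]]; rewrite bot_inv2 -!catA.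
Qed.

(** The deleted factor, a backtrack or a boundary loop, is closed. *)
Lemma elementary_sqwalk s t x y :
  @elementary (Sq K) s t -> sqwalk x s y -> sqwalk x t y.
Proof.
case=> [p e q|p c q] /walk_cat[z wp].
  move=> [Ez [_ wq]]; apply: sqwalk_cat wp _.
  by move: wq Ez; rewrite /= bot_inv2 => wq <-.
move=> /walk_cat[z' /sqwalk_bd[_ ->] wq]; exact: sqwalk_cat wp wq.
Qed.

(** The walk condition is put on [s], the longer side: deletions preserve walks, while an insertion
    could break one. Hence sequences related to a walk from [x] to [y] are again such walks. The
    ends are bare words, so that concatenating paths involves no transport of proofs. *)
Definition sqhom x y : seq (sq_edge K) -> seq (sq_edge K) -> Prop :=
  clos_refl_sym_trans _ (fun s t => sqwalk x s y /\ @elementary (Sq K) s t).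

Lemma sqhom_refl x y s : sqhom x y s s. Proof. exact: rst_refl. Qed.

Lemma sqhom_sym x y s t : sqhom x y s t -> sqhom x y t s.
Proof. exact: rst_sym. Qed.

Lemma sqhom_trans x y t s r : sqhom x y s t -> sqhom x y t r -> sqhom x y s r.
Proof. exact: rst_trans. Qed.

Lemma sqhom_catl r s t x y z : sqwalk z r x -> sqhom x y s t ->
  sqhom z y (r ++ s) (r ++ t).
Proof.
move=> wr; elim=> [{}s {}t [ws st]|l|l l' _|l l' l'' _ h _ h'].
- apply: rst_step; split; first exact: sqwalk_cat wr ws.
  case: st {ws} => [p e q|p c q]; rewrite !(catA r p).
  + exact: (@elementary_inv (Sq K)).
  + exact: (@elementary_bd (Sq K)).
- exact: sqhom_refl.
- exact: sqhom_sym.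
- exact: sqhom_trans h h'.
Qed.

Lemma sqhom_catr r s t x y z : sqwalk y r z -> sqhom x y s t ->
  sqhom x z (s ++ r) (t ++ r).
Proof.
move=> wr; elim=> [{}s {}t [ws st]|l|l l' _|l l' l'' _ h _ h'].
- apply: rst_step; split; first exact: sqwalk_cat ws wr.
  case: st {ws} => [p e q|p c q]; rewrite -!catA.
  + exact: (@elementary_inv (Sq K) p e (q ++ r)).
  + exact: (@elementary_bd (Sq K) p c (q ++ r)).
- exact: sqhom_refl.
- exact: sqhom_sym.
- exact: sqhom_trans h h'.
Qed.

Lemma sqhom_cancel s x y : sqwalk x s y -> sqhom x x (s ++ sqrev s) [::].
Proof.
elim/last_ind: s y => [|s e IH] y; first by move=> _; apply: sqhom_refl.
rewrite /sqrev rev_rcons /= cat_rcons => /[dup] wse.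
rewrite -cats1 => /walk_cat[z ws _].
apply: sqhom_trans (IH _ ws); apply: rst_step; split.
  by have := sqwalk_cat wse (sqwalk_rev wse); rewrite /sqrev rev_rcons cat_rcons.
exact: (@elementary_inv (Sq K) s e (sqrev s)).
Qed.

Lemma sqhom_inv e : sqhom (sq_source e) (sq_source e) [:: e; sq_inv e] [::].
Proof.
by apply: (@sqhom_cancel [:: e] _ (sq_target e)).
Qed.

Lemma sqhom_homotopic (v : sq_vertex K) (l l' : @loop (Sq K) v) :
  homotopic l l' <-> sqhom v v l l'.
Proof.
split.
  elim=> {l l'} [l l' s|l|l l' _|l l' l'' _ h _ h'].
  - by apply: rst_step; split=> //; apply/sqwalkP; exact: (loopP l).
  - exact: sqhom_refl.
  - exact: sqhom_sym.
  - exact: sqhom_trans h h'.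
move: (loopP l) (loopP l'); case: l l' => s ws [t wt] /= _ _ st.
(* The induction runs through bare sequences, which must be repackaged as loops to apply
   transitivity of [homotopic]; it therefore also carries the fact that being a loop at [v] is
   preserved in both directions. *)
suff H a b : sqhom v v a b -> (sqwalk v a v <-> sqwalk v b v) /\
    (forall (l l' : @loop (Sq K) v), loop_seq l = a -> loop_seq l' = b ->
       homotopic l l').
  by have [_ {}H] := H _ _ st; exact: H.
elim=> {s t ws wt st a b}
    [s t [ws st]|s|s t _ [sv st]|s r t _ [sr hr] _ [rt ht]].
- have wt := elementary_sqwalk st ws.
  by split=> // l l' El El'; apply: rst_step; rewrite El El'.
- split=> // l l' El El'; rewrite (@loop_inj _ _ l l') ?El ?El' //.
  exact: rst_refl.
- by split=> [|l l' El El']; [exact: iff_sym | apply/rst_sym/st].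
- split=> [|l l' El El']; first exact: iff_trans sr rt.
  have wr : @walk (Sq K) v r v.
    by apply/sqwalkP/sr/sqwalkP; rewrite -El; exact: (loopP l).
  apply: (@rst_trans _ _ _ (@Loop (Sq K) v r wr)); [exact: hr | exact: ht].
Qed.

(* Read on the square with boundary [sq_bd c], which is [E1 E2 E3^-1 E4^-1]. *)
Lemma sqhom_square (c : sq_cell K) :
  sqhom (sq_source (SqEdge (sq_edge1_subproof c)))
    (sq_target (SqEdge (sq_edge2_subproof c)))
    [:: SqEdge (sq_edge1_subproof c); SqEdge (sq_edge2_subproof c)]
    [:: SqEdge (sq_edge4_subproof c); SqEdge (sq_edge3_subproof c)].
Proof.
set E1 := SqEdge (sq_edge1_subproof c); set E2 := SqEdge (sq_edge2_subproof c).
set E3 := SqEdge (sq_edge3_subproof c); set E4 := SqEdge (sq_edge4_subproof c).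
have w12 : sqwalk (sq_source E1) [:: E1; E2] (sq_target E2).
  by rewrite /= -!catA.
have w43 : sqwalk (sq_source E1) [:: E4; E3] (sq_target E2).
  by rewrite /= -!catA.
(* Insert [E3^-1 E4^-1 E4 E3] after [E1 E2]: the first four edges then form the boundary loop, whose
   deletion leaves [E4 E3]. *)
have /= := sqhom_catl w12 (sqhom_sym (sqhom_cancel (sqwalk_rev w43))).
rewrite /sqrev /= !sq_invK => /sqhom_trans; apply.
apply: (@sqhom_trans _ _ ([::] ++ sq_bd c ++ [:: E4; E3])); first exact: sqhom_refl.
apply: rst_step; split; last exact: (@elementary_bd (Sq K) [::] c [:: E4; E3]).
by rewrite /= !(top_inv2, bot_inv2) -!catA.
Qed.

End SquierPaths.

Notation sqwalk := (@walk (word_graph _)).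

(** * Maps of edge paths induced by maps from edges to paths *)

Section Functor.
Variables (K K' : directed_2complex) (h : seq (arrow K) -> seq (arrow K')).
Variables (phi : sq_edge K -> seq (sq_edge K')) (P : seq (arrow K) -> Prop).
Hypothesis P_step : forall e : sq_edge K, P (sq_source e) -> P (sq_target e).
Hypothesis phi_walk : forall e : sq_edge K, P (sq_source e) ->
  sqwalk (h (sq_source e)) (phi e) (h (sq_target e)).
Hypothesis phi_inv : forall e : sq_edge K, P (sq_source e) ->
  sqhom (h (sq_source e)) (h (sq_source e)) (phi e ++ phi (sq_inv e)) [::].
Hypothesis phi_bd : forall c : sq_cell K,
  let x := sq_source (SqEdge (sq_edge1_subproof c)) in
  P x -> sqhom (h x) (h x) (flatten (map phi (sq_bd c))) [::].

Lemma functor_walk s x y : P x -> sqwalk x s y ->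
  P y /\ sqwalk (h x) (flatten (map phi s)) (h y).
Proof.
elim: s x => [|e s IH] x Px /=; first by move=> <-.
case=> Ex; rewrite -{}Ex in Px *; move=> ws.
have [Py wy] := IH _ (P_step Px) ws.
by split=> //; apply: sqwalk_cat (phi_walk Px) wy.
Qed.

(** It suffices that backtracks and boundary loops go to null-homotopic loops. The predicate [P]
    singles out the words with a meaningful image; by [P_step] it propagates along walks, so the
    hypotheses on [phi] are asked only at sources satisfying [P]. *)
Lemma functor_hom s t x y : P x -> sqhom x y s t ->
  sqhom (h x) (h y) (flatten (map phi s)) (flatten (map phi t)).
Proof.
move=> Px; elim=> {s t} [s t [ws st]|l|l l' _|l l' l'' _ H _ H'].
- case: st ws => [p e q|p c q] /walk_cat[z wp /walk_cat[z' wm wq]];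
    have [Pz hp] := functor_walk Px wp; rewrite !map_cat !flatten_cat;
    apply: sqhom_catl hp _.
  + have [Ez [_ Ez']] := wm.
    have {}Ez : sqv_path (sq_source e) = z by [].
    have {}Ez' : sqv_path (sq_source e) = z' by rewrite -Ez' /= bot_inv2.
    rewrite -{}Ez' -{}Ez in Pz wq *; have [_ hq] := functor_walk Pz wq.
    by have := sqhom_catr hq (phi_inv Pz); rewrite /= cats0 -catA.
  + have [Ez Ez'] := sqwalk_bd wm; rewrite {}Ez' {}Ez in Pz wq *.
    have [_ hq] := functor_walk Pz wq.
    exact: sqhom_catr hq (phi_bd Pz).
- exact: sqhom_refl.
- exact: sqhom_sym.
- exact: sqhom_trans H H'.
Qed.

End Functor.

(** * Copies of a complex between fixed words, and commutation of disjoint rewritings *)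

Section Embedding.
Variable L : directed_2complex.
Hypothesis L_path : forall s : seq (arrow L), is_1path s.

Definition word_edge p f q : sq_edge L :=
  @SqEdge L p f q (L_path (p ++ top f ++ q)).

Lemma word_edgeE e : e = word_edge (sqe_left e) (sqe_cell e) (sqe_right e).
Proof. exact: sq_edge_eq. Qed.

Section Map.
Variables (K : directed_2complex) (h : seq (arrow K) -> seq (arrow L)).
Variables (c : cell2 K -> cell2 L).
Hypothesis h_cat : {morph h : s t / s ++ t}.
Hypothesis top_c : forall f, top (c f) = h (top f).
Hypothesis inv2_c : forall f, c (inv2 f) = inv2 (c f).
Variables (P Q : seq (arrow L)).

Definition embed (e : sq_edge K) : sq_edge L :=
  word_edge (P ++ h (sqe_left e)) (c (sqe_cell e)) (h (sqe_right e) ++ Q).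

Lemma bot_c f : bot (c f) = h (bot f).
Proof. by rewrite -!top_inv2 -inv2_c top_c. Qed.

Lemma embed_source e : sq_source (embed e) = P ++ h (sq_source e) ++ Q :> seq _.
Proof. by rewrite /= top_c !h_cat -!catA. Qed.

Lemma embed_target e : sq_target (embed e) = P ++ h (sq_target e) ++ Q :> seq _.
Proof. by rewrite /= bot_c !h_cat -!catA. Qed.

Lemma embed_inv e : embed (sq_inv e) = sq_inv (embed e).
Proof. by apply: sq_edge_eq => //=. Qed.

Definition embed_cell (d : sq_cell K) : sq_cell L :=
  @SqCell L (P ++ h (sqc_p d)) (c (sqc_f d)) (h (sqc_q d)) (c (sqc_g d))
    (h (sqc_r d) ++ Q) (L_path _).

Lemma embed_bd (d : sq_cell K) : map embed (sq_bd d) = sq_bd (embed_cell d).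
Proof.
rewrite /sq_bd /=; congr [:: _; _; _; _]; apply: sq_edge_eq => //=;
  by rewrite ?top_c ?bot_c !h_cat -!catA.
Qed.

Lemma embed_source_bd (d : sq_cell K) :
  P ++ h (sq_source (SqEdge (sq_edge1_subproof d))) ++ Q =
  sq_source (SqEdge (sq_edge1_subproof (embed_cell d))).
Proof. by rewrite /= !top_c !h_cat -!catA. Qed.

Let embed_walk1 (e : sq_edge K) : True ->
  sqwalk (P ++ h (sq_source e) ++ Q) [:: embed e] (P ++ h (sq_target e) ++ Q).
Proof. by move=> _; split; [apply: embed_source | apply: embed_target]. Qed.

Lemma embed_walk s x y : sqwalk x s y ->
  sqwalk (P ++ h x ++ Q) (map embed s) (P ++ h y ++ Q).
Proof.
move=> ws; rewrite -(flatten_map1 embed).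
by have [] := @functor_walk K L (fun x => P ++ h x ++ Q) (fun e => [:: embed e])
  (fun=> True) (fun _ _ => I) embed_walk1 s x y I ws.
Qed.

(** Embedding commutes with inversion of edges and sends the boundary of a square to the boundary of
    a square, so [functor_hom] applies. *)
Lemma embed_hom s t x y : sqhom x y s t ->
  sqhom (P ++ h x ++ Q) (P ++ h y ++ Q) (map embed s) (map embed t).
Proof.
move=> st; rewrite -!(flatten_map1 embed).
apply: (@functor_hom K L (fun x => P ++ h x ++ Q) (fun e => [:: embed e])
  (fun=> True) _ embed_walk1 _ _ s t x y I st) => // [e _|d x' _].
  rewrite /= embed_inv -embed_source; exact: sqhom_inv.
rewrite flatten_map1 embed_bd /x' embed_source_bd; apply: rst_step; split.
  by split=> //=; rewrite !(top_inv2, bot_inv2) -!catA.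
exact: (@elementary_bd (Sq L) [::] (embed_cell d) [::]).
Qed.

End Map.

Definition shift p : sq_edge L -> sq_edge L := embed id id p [::].

Lemma shiftE p q f r : shift p (word_edge q f r) = word_edge (p ++ q) f r.
Proof. by apply: sq_edge_eq => //=; rewrite cats0. Qed.

Lemma shift_cat p q e : shift p (shift q e) = shift (p ++ q) e.
Proof. by apply: sq_edge_eq => /=; rewrite ?cats0 ?catA. Qed.

Lemma shift0 e : shift [::] e = e.
Proof. by apply: sq_edge_eq => //=; rewrite cats0. Qed.

Lemma shift_walk p s x y :
  sqwalk x s y -> sqwalk (p ++ x) (map (shift p) s) (p ++ y).
Proof.
by move=> /(@embed_walk L id id _ _ _ p [::]); rewrite !cats0; apply.
Qed.

Lemma shift_hom p s t x y : sqhom x y s t ->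
  sqhom (p ++ x) (p ++ y) (map (shift p) s) (map (shift p) t).
Proof.
by move=> /(@embed_hom L id id _ _ _ p [::]); rewrite !cats0; apply.
Qed.

(* Rewritings of disjoint factors commute, the squares of [Sq L] being its
   2-cells. *)
Lemma sqhom_comm p f s x y : sqwalk x s y ->
  sqhom (p ++ top f ++ x) (p ++ bot f ++ y)
    (word_edge p f x :: map (shift (p ++ bot f)) s)
    (rcons (map (shift (p ++ top f)) s) (word_edge p f y)).
Proof.
elim: s x => [|e s IH] x; first by move=> /= ->; apply: sqhom_refl.
move=> [<- ws]; have {IH} := IH _ ws; rewrite (word_edgeE e).
case: e ws => q g r _ /= ws IH; rewrite !shiftE -!catA.
pose d := @SqCell L p f q g r (L_path _).
have E1 : word_edge p f (q ++ top g ++ r) = SqEdge (sq_edge1_subproof d).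
  exact: sq_edge_eq.
have E2 : word_edge (p ++ bot f ++ q) g r = SqEdge (sq_edge2_subproof d).
  exact: sq_edge_eq.
have E3 : word_edge p f (q ++ bot g ++ r) = SqEdge (sq_edge3_subproof d).
  exact: sq_edge_eq.
have E4 : word_edge (p ++ top f ++ q) g r = SqEdge (sq_edge4_subproof d).
  exact: sq_edge_eq.
have w := shift_walk (p ++ bot f) ws.
have := sqhom_square d; rewrite -E1 -E2 -E3 -E4 => H.
(* The square [d] moves [f] past the first edge of the walk, and the induction hypothesis moves it
   past the others. *)
apply: (@sqhom_trans _ _ _ ([:: word_edge (p ++ top f ++ q) g r;
  word_edge p f (q ++ bot g ++ r)] ++ map (shift (p ++ bot f)) s)).
  apply: (@sqhom_catr _ _ [:: _; _]) H.
  by rewrite /= -!catA in w *.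
have w4 : sqwalk (p ++ top f ++ q ++ top g ++ r)
  [:: word_edge (p ++ top f ++ q) g r] (p ++ top f ++ q ++ bot g ++ r).
  by rewrite /= -!catA.
exact: (sqhom_catl w4 IH).
Qed.

End Embedding.

(** * The product complex *)

Section ProductComplex.
Variables (I : countType) (K : I -> directed_2complex).
Variable w : forall i, sq_vertex (K i).
Implicit Types (i j : I) (n k : nat) (E : seq I).

Local Notation word i := (seq (arrow (K i))).

Variant letter :=
  | Arr (a : {i : I & arrow (K i)})
  | Mark (i : I)
  | Tail (n : nat).

Definition arr i (x : arrow (K i)) : letter := Arr (Tagged (fun i => arrow (K i)) x).

Implicit Types (u : forall i, word i) (p q r : seq letter).

Definition block u i : seq letter := Mark i :: map (@arr i) (u i).
Definition blocks u E : seq letter := flatten (map (block u) E).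

Definition base i : word i := w i.

(** The indices with code in the interval from [n] to [n + k], right end excluded. For [k = 1] there
    is one index or none, so that codes of no index need no separate treatment. *)
Definition idx n k : seq I := pmap pickle_inv (iota n k).

Definition unfolding n : seq letter := blocks base (idx n 1) ++ [:: Tail n.+1].

(* [Unfold true n] rewrites [Tail n] to [unfolding n]; the letter [Mark i] in
   front of a block ensures that the inverse cell applies only if the whole
   block of [i] is [w i]. *)
Variant prod_cell :=
  | Inner (c : {i : I & cell2 (K i)})
  | Unfold (b : bool) (n : nat).

Definition inner i (f : cell2 (K i)) : prod_cell :=
  Inner (Tagged (fun i => cell2 (K i)) f).

Definition prod_top (f : prod_cell) : seq letter :=
  match f with
  | Inner c => map (@arr (tag c)) (top (tagged c))
  | Unfold b n => if b then [:: Tail n] else unfolding n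
  end.

Definition prod_inv (f : prod_cell) : prod_cell :=
  match f with
  | Inner c => inner (inv2 (tagged c))
  | Unfold b n => Unfold (~~ b) n
  end.

Definition prod_bot (f : prod_cell) : seq letter := prod_top (prod_inv f).

(** With a single vertex every word is a path, which frees the edges from side conditions. Words
    whose projection to some [K i] is not a path then exist as well; [on_path] excludes them where
    needed. *)
Definition prod_graph : digraph := @Digraph unit letter (fun=> tt) (fun=> tt).

Lemma prod_walk (s : seq letter) : @walk prod_graph tt s tt.
Proof. by elim: s. Qed.

Lemma prod_top_neq0 f : prod_top f <> [::].
Proof.
case: f => [[i f]|[] n] //=; last by rewrite /unfolding; case: (blocks _ _).
by have := @top_neq0 _ f; case: (top f).
Qed.

Lemma prod_bot_neq0 f : prod_bot f <> [::].
Proof. exact: prod_top_neq0. Qed.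

Lemma prod_parallel f : exists x y : vertex prod_graph,
  @walk prod_graph x (prod_top f) y /\ @walk prod_graph x (prod_bot f) y.
Proof. by exists tt, tt; split; apply: prod_walk. Qed.

Lemma prod_invK : involutive prod_inv.
Proof. by case=> [[i f]|b n] /=; rewrite ?negbK // /inner /= inv2K. Qed.

Lemma prod_inv_neq f : prod_inv f <> f.
Proof.
by case: f => [[i f] []|[] n] //= /(@eq_from_Tagged _ (fun i => cell2 (K i))) /inv2_neq.
Qed.

Lemma prod_bot_inv f : prod_bot (prod_inv f) = prod_top f.
Proof. by rewrite /prod_bot prod_invK. Qed.

Definition prod_complex : directed_2complex :=
  @Directed2Complex prod_graph prod_cell prod_top prod_bot prod_inv
    prod_top_neq0 prod_bot_neq0 prod_parallel prod_invK prod_inv_neq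
    (fun=> erefl) prod_bot_inv.

Lemma prod_path (s : seq (arrow prod_complex)) : is_1path s.
Proof. by exists tt, tt; apply: prod_walk. Qed.

(** * Projections of words and edges to the factors *)

Local Notation pedge := (@word_edge prod_complex prod_path).
Local Notation pshift := (@shift prod_complex prod_path).

(* [Tail n] stands for the product of all the [w i] with [n <= pickle i], so
   that [wproj i] below identifies the two sides of every cell not in [K i]. *)
Definition lproj i (l : letter) : word i :=
  match l with
  | Arr a => untag [::] (fun x : arrow (K i) => [:: x]) a
  | Mark _ => [::]
  | Tail n => if n <= pickle i then base i else [::]
  end.

Definition wproj i (s : seq letter) : word i := flatten (map (lproj i) s).

Lemma wproj_cat i (s r : seq letter) : wproj i (s ++ r) = wproj i s ++ wproj i r.
Proof. by rewrite /wproj map_cat flatten_cat. Qed.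

Lemma wproj_cons i l (s : seq letter) : wproj i (l :: s) = lproj i l ++ wproj i s.
Proof. by []. Qed.

Lemma wproj_arr i (s : word i) : wproj i (map (@arr i) s) = s.
Proof.
elim: s => //= x s; rewrite wproj_cons => -> /=.
by rewrite (untagE _ _ (erefl : tag (Tagged (fun i => arrow (K i)) x) = i)).
Qed.

Lemma wproj_arr_neq i j (s : word j) : j != i -> wproj i (map (@arr j) s) = [::].
Proof.
by move=> ji; elim: s => //= x s; rewrite wproj_cons => -> /=; rewrite untag_dflt.
Qed.

Lemma arr_inj i : injective (@arr i).
Proof. by move=> x y [] /(@eq_from_Tagged _ (fun i => arrow (K i))). Qed.

Lemma blocks_cat u E E' : blocks u (E ++ E') = blocks u E ++ blocks u E'.
Proof. by rewrite /blocks map_cat flatten_cat. Qed.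

Lemma blocks_cons u i E : blocks u (i :: E) = block u i ++ blocks u E.
Proof. by []. Qed.

Lemma eq_blocks u u' E : {in E, forall i, u i = u' i} -> blocks u E = blocks u' E.
Proof.
by move=> uu'; congr flatten; apply/eq_in_map => i /uu'; rewrite /block => ->.
Qed.

Lemma wproj_block_neq u i j : j != i -> wproj i (block u j) = [::].
Proof. by move=> ji; rewrite wproj_cons wproj_arr_neq. Qed.

Lemma wproj_blocks0 u i E : i \notin E -> wproj i (blocks u E) = [::].
Proof.
elim: E => //= j E IH; rewrite inE negb_or eq_sym => /andP[ji /IH iE].
by rewrite blocks_cons wproj_cat wproj_block_neq.
Qed.

Lemma wproj_blocks u i E : uniq E -> i \in E -> wproj i (blocks u E) = u i.
Proof.
elim: E => //= j E IH /andP[jE uE]; rewrite inE blocks_cons wproj_cat.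
have [->|ij] /= := eqVneq; first by rewrite wproj_blocks0 // cats0 wproj_cons wproj_arr.
by move=> iE; rewrite wproj_block_neq 1?eq_sym //= IH.
Qed.

Lemma mem_idx n k i : (i \in idx n k) = (n <= pickle i < n + k).
Proof. by rewrite (can2_mem_pmap pickle_invK pickleK_inv) mem_iota. Qed.

Lemma idx_uniq n k : uniq (idx n k).
Proof. by rewrite (pmap_uniq pickle_invK) ?iota_uniq. Qed.

Lemma idx_cat n k k' : idx n (k + k') = idx n k ++ idx (n + k) k'.
Proof. by rewrite /idx iotaD pmap_cat. Qed.

(** In the unfolded word, [base i] comes from the block if [i] has code [n], and from [Tail n.+1] if
    its code is larger. *)
Lemma wproj_unfold i b n :
  wproj i (prod_top (Unfold b n)) = if n <= pickle i then base i else [::].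
Proof.
case: b; first by rewrite /wproj /= cats0.
rewrite /= /unfolding wproj_cat {2}/wproj /= cats0.
have := mem_idx n 1 i; rewrite addn1 ltnS -eqn_leq.
case: ltngtP => [ni|ni|->] E; last by rewrite wproj_blocks ?E ?idx_uniq // cats0.
- by rewrite wproj_blocks0 ?E.
- by rewrite wproj_blocks0 ?E.
Qed.

Definition active i (f : prod_cell) : bool :=
  if f is Inner c then tag c == i else false.

Lemma active_inv i f : active i (prod_inv f) = active i f.
Proof. by case: f. Qed.

Lemma activeP i f : reflect (exists g, f = @inner i g) (active i f).
Proof.
apply: (iffP idP) => [|[g ->]]; last exact: eqxx.
by case: f => //= -[j f] /= /eqP ji; case: _ / ji; exists f.
Qed.

Lemma wproj_inactive i f : ~~ active i f -> wproj i (prod_bot f) = wproj i (prod_top f).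
Proof.
case: f => [[j f] ji|b n _]; last by rewrite !wproj_unfold.
by rewrite /prod_bot /= !wproj_arr_neq.
Qed.

Lemma bot_inner i (f : cell2 (K i)) : prod_bot (inner f) = map (@arr i) (bot f).
Proof. by rewrite -top_inv2. Qed.

(** Edges whose cell does not come from [K i] collapse to the empty path. The default for a
    projected context that is not a path is never met at sources satisfying [on_path i]. *)
Definition eproj i (e : sq_edge prod_complex) : seq (sq_edge (K i)) :=
  if sqe_cell e is Inner c then
    untag [::] (fun f : cell2 (K i) =>
      if pselect (is_1path (wproj i (sqe_left e) ++ top f ++ wproj i (sqe_right e)))
      is left H then [:: SqEdge H] else [::]) c
  else [::].

Lemma eproj_inactive i (e : sq_edge prod_complex) :
  ~~ active i (sqe_cell e) -> eproj i e = [::].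
Proof.
by rewrite /eproj; case: (sqe_cell e : prod_cell) => //= c ci; rewrite untag_dflt.
Qed.

Lemma eproj_inner i (e : sq_edge prod_complex) (d : sq_edge (K i)) :
  sqe_cell e = inner (sqe_cell d) ->
  wproj i (sqe_left e) = sqe_left d -> wproj i (sqe_right e) = sqe_right d ->
  eproj i e = [:: d].
Proof.
rewrite /eproj => -> El Er /=.
rewrite (untagE _ _
  (erefl : tag (Tagged (fun i => cell2 (K i)) (sqe_cell d)) = i)) /=.
case: pselect => [H|]; first by congr [:: _]; apply: sq_edge_eq.
by case; rewrite El Er; apply: sqe_1path.
Qed.

Definition on_path i (s : seq letter) := is_1path (wproj i s).

Lemma source_active i (e : sq_edge prod_complex) g : sqe_cell e = inner g ->
  wproj i (sq_source e) = wproj i (sqe_left e) ++ top g ++ wproj i (sqe_right e).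
Proof. by move=> /= ->; rewrite !wproj_cat wproj_arr. Qed.

Lemma target_active i (e : sq_edge prod_complex) g : sqe_cell e = inner g ->
  wproj i (sq_target e) = wproj i (sqe_left e) ++ bot g ++ wproj i (sqe_right e).
Proof. by move=> /= ->; rewrite !wproj_cat bot_inner wproj_arr. Qed.

Lemma target_inactive i (e : sq_edge prod_complex) :
  ~~ active i (sqe_cell e) -> wproj i (sq_target e) = wproj i (sq_source e).
Proof. by move=> /= /wproj_inactive; rewrite !wproj_cat => ->. Qed.

Lemma on_path_step i (e : sq_edge prod_complex) :
  on_path i (sq_source e) -> on_path i (sq_target e).
Proof.
rewrite /on_path; have [[g eg]|ne] := activeP i (sqe_cell e).
  by rewrite (source_active eg) (target_active eg); apply: is_1path_bot.
by rewrite target_inactive //; apply/activeP.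
Qed.

Implicit Types s t : seq (sq_edge prod_complex).

Lemma eproj_walk i (e : sq_edge prod_complex) : on_path i (sq_source e) ->
  sqwalk (wproj i (sq_source e)) (eproj i e) (wproj i (sq_target e)).
Proof.
rewrite /on_path; have [[g eg]|ne] := activeP i (sqe_cell e).
  rewrite (source_active eg) (target_active eg) => H.
  by rewrite (eproj_inner (d := SqEdge H)).
by move=> _; rewrite target_inactive ?eproj_inactive //; apply/activeP.
Qed.

Lemma eproj_inv i (e : sq_edge prod_complex) : on_path i (sq_source e) ->
  sqhom (wproj i (sq_source e)) (wproj i (sq_source e))
    (eproj i e ++ eproj i (sq_inv e)) [::].
Proof.
rewrite /on_path; have [[g eg]|ne] := activeP i (sqe_cell e).
  rewrite (source_active eg) => H; rewrite (eproj_inner (d := SqEdge H)) //.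
  rewrite (eproj_inner (d := sq_inv (SqEdge H))) /= ?eg //.
  exact: (sqhom_inv (SqEdge H)).
move=> _; rewrite !eproj_inactive //=; first exact: sqhom_refl.
  by rewrite active_inv; apply/activeP.
exact/activeP.
Qed.

(** If both cells of the square come from [K i], its boundary projects to the boundary of a square;
    if just one does, to a backtrack; if none does, to the empty path. *)
Lemma eproj_bd i (c : sq_cell prod_complex) :
  let x := sq_source (SqEdge (sq_edge1_subproof c)) in
  on_path i x -> sqhom (wproj i x) (wproj i x) (flatten (map (eproj i) (sq_bd c))) [::].
Proof.
case: c => p f q g r H /=; rewrite /on_path /= !wproj_cat.
have [[f' Ef]|nf] := activeP i f; have [[g' Eg]|ng] := activeP i g.
- subst f g; rewrite !wproj_arr => H'.
  pose d := @SqCell (K i) (wproj i p) f' (wproj i q) g' (wproj i r) H'.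
  rewrite (eproj_inner (d := SqEdge (sq_edge1_subproof d))) //=; last first.
    by rewrite !wproj_cat wproj_arr.
  rewrite (eproj_inner (d := SqEdge (sq_edge2_subproof d))) //=; last first.
    by rewrite !wproj_cat bot_inner wproj_arr.
  rewrite (eproj_inner (d := sq_inv (SqEdge (sq_edge3_subproof d)))) //=; last first.
    by rewrite !wproj_cat bot_inner wproj_arr.
  rewrite (eproj_inner (d := sq_inv (SqEdge (sq_edge4_subproof d)))) //=; last first.
    by rewrite !wproj_cat wproj_arr.
  apply: rst_step; split; last exact: (@elementary_bd (Sq (K i)) [::] d [::]).
  by split=> //=; rewrite !(top_inv2, bot_inv2) -!catA.
- subst f; rewrite wproj_arr => H'.
  rewrite (eproj_inner (d := SqEdge H')) //=; last by rewrite !wproj_cat.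
  rewrite eproj_inactive; last exact/activeP.
  rewrite (eproj_inner (d := sq_inv (SqEdge H'))) //=; last first.
    by rewrite !wproj_cat wproj_inactive //; apply/activeP.
  rewrite eproj_inactive /=; last by rewrite active_inv; apply/activeP.
  exact: (sqhom_inv (SqEdge H')).
- subst g; rewrite wproj_arr catA (catA _ (wproj i q)) => H'.
  rewrite eproj_inactive; last exact/activeP.
  rewrite (eproj_inner (d := SqEdge H')) //=; last first.
    by rewrite !wproj_cat wproj_inactive ?catA //; apply/activeP.
  rewrite eproj_inactive; last by rewrite /= active_inv; apply/activeP.
  rewrite (eproj_inner (d := sq_inv (SqEdge H'))) //=; last by rewrite !wproj_cat catA.
  have := sqhom_inv (SqEdge H'); by rewrite /= -!catA.
- move=> _; rewrite !eproj_inactive /= ?active_inv; do ?exact/activeP.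
  exact: sqhom_refl.
Qed.

(** * Projecting paths to the factors and lifting them back *)

Local Notation pwalk := (@walk (word_graph prod_complex)).
Local Notation phom := (@sqhom prod_complex).

Definition pproj i (s : seq (sq_edge prod_complex)) : seq (sq_edge (K i)) :=
  flatten (map (eproj i) s).

Lemma pproj_cat i s t : pproj i (s ++ t) = pproj i s ++ pproj i t.
Proof. by rewrite /pproj map_cat flatten_cat. Qed.

Lemma pproj_rcons i s e : pproj i (rcons s e) = pproj i s ++ eproj i e.
Proof. by rewrite -cats1 pproj_cat /pproj /= cats0. Qed.

Lemma pproj_walk i s x y : on_path i x -> pwalk x s y ->
  sqwalk (wproj i x) (pproj i s) (wproj i y).
Proof. by move=> px /(functor_walk (@on_path_step i) (@eproj_walk i) px) []. Qed.

Lemma pproj_hom i s t x y : on_path i x -> phom x y s t ->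
  sqhom (wproj i x) (wproj i y) (pproj i s) (pproj i t).
Proof.
exact: (functor_hom (@on_path_step i) (@eproj_walk i) (@eproj_inv i) (@eproj_bd i)).
Qed.

Definition lift i p q : sq_edge (K i) -> sq_edge prod_complex :=
  @embed prod_complex prod_path (K i) (map (@arr i)) (@inner i) p q.

Lemma lift_target i p q (e : sq_edge (K i)) :
  sq_target (lift p q e) = p ++ map (@arr i) (sq_target e) ++ q :> seq letter.
Proof. by rewrite /= bot_inner !map_cat -!catA. Qed.

Lemma lift_walk i p q (s : seq (sq_edge (K i))) x y : sqwalk x s y ->
  pwalk (p ++ map (@arr i) x ++ q) (map (lift p q) s) (p ++ map (@arr i) y ++ q).
Proof. exact: (embed_walk _ (@map_cat _ _ _)). Qed.

Lemma lift_hom i p q (s t : seq (sq_edge (K i))) x y : sqhom x y s t ->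
  phom (p ++ map (@arr i) x ++ q) (p ++ map (@arr i) y ++ q)
    (map (lift p q) s) (map (lift p q) t).
Proof. exact: (embed_hom _ (@map_cat _ _ _)). Qed.

Lemma eproj_lift i p q e : wproj i p = [::] -> wproj i q = [::] ->
  eproj i (lift p q e) = [:: e].
Proof.
move=> p0 q0; apply: eproj_inner;
  by rewrite //= wproj_cat wproj_arr ?p0 ?q0 ?cats0.
Qed.

Lemma eproj_lift_neq i j p q (e : sq_edge (K j)) :
  j != i -> eproj i (lift p q e) = [::].
Proof. by move=> ji; apply: eproj_inactive. Qed.

Lemma eproj_shift i p e : wproj i p = [::] -> eproj i (pshift p e) = eproj i e.
Proof. by move=> p0; rewrite /eproj /= cats0 wproj_cat p0. Qed.

Lemma pproj_lift i p q (s : seq (sq_edge (K i))) :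
  wproj i p = [::] -> wproj i q = [::] ->
  pproj i (map (lift p q) s) = s.
Proof.
move=> p0 q0; elim: s => //= e s IH; rewrite /pproj /=.
by rewrite eproj_lift //= -/(pproj _ _) IH.
Qed.

Lemma pproj_lift_neq i j p q (s : seq (sq_edge (K j))) : j != i ->
  pproj i (map (lift p q) s) = [::].
Proof. by move=> ji; elim: s => //= e s IH; rewrite /pproj /= eproj_lift_neq. Qed.

Lemma pproj_shift i p s : wproj i p = [::] -> pproj i (map (pshift p) s) = pproj i s.
Proof.
move=> p0; elim: s => //= e s IH.
by rewrite /pproj /= eproj_shift // -!/(pproj _ _) IH.
Qed.

(** * Unfolding the tail and running paths inside the blocks *)

Definition unfold n : sq_edge prod_complex := pedge [::] (Unfold true n) [::].

Fixpoint unfolds n k : seq (sq_edge prod_complex) :=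
  if k is k'.+1 then unfold n :: map (pshift (blocks base (idx n 1))) (unfolds n.+1 k')
  else [::].

Lemma idxS n k : idx n k.+1 = idx n 1 ++ idx n.+1 k.
Proof. by rewrite -add1n idx_cat addn1. Qed.

Lemma idxSr n k : idx n k.+1 = idx n k ++ idx (n + k) 1.
Proof. by rewrite -addn1 idx_cat. Qed.

Lemma unfolds_walk n k :
  pwalk [:: Tail n] (unfolds n k) (blocks base (idx n k) ++ [:: Tail (n + k)]).
Proof.
elim: k n => [|k IH] n; first by rewrite addn0.
rewrite idxS blocks_cat -catA addnS -addSn; split=> //=.
by rewrite cats0; exact: (shift_walk prod_path (blocks base (idx n 1)) (IH n.+1)).
Qed.

Definition inactive i (e : sq_edge prod_complex) : bool := ~~ active i (sqe_cell e).

Lemma pproj_inactive i s : all (inactive i) s -> pproj i s = [::].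
Proof.
by elim: s => //= e s IH /andP[ne /IH s0]; rewrite /pproj /= eproj_inactive.
Qed.

Lemma unfolds_inactive i n k : all (inactive i) (unfolds n k).
Proof. by elim: k n => //= k IH n; rewrite all_map; apply: IH. Qed.

Lemma pproj_unfolds i n k : pproj i (unfolds n k) = [::].
Proof. exact/pproj_inactive/unfolds_inactive. Qed.

Lemma pproj_unfolds_rev i n k : pproj i (sqrev (unfolds n k)) = [::].
Proof.
apply: pproj_inactive; rewrite all_map all_rev.
by apply: sub_all (unfolds_inactive i n k) => e; rewrite /inactive /= active_inv.
Qed.

Implicit Types (T : forall i, seq (sq_edge (K i))).

(* From [blocks base E ++ q] to [blocks u E ++ q], running [T i] inside the
   block of [i], for each [i] in [E] in turn. *)
Fixpoint act T u E q : seq (sq_edge prod_complex) :=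
  if E is i :: E' then
    map (lift [:: Mark i] (blocks base E' ++ q)) (T i) ++
    map (pshift (block u i)) (act T u E' q)
  else [::].

Lemma act_cons T u i E q : act T u (i :: E) q =
  map (lift [:: Mark i] (blocks base E ++ q)) (T i) ++
  map (pshift (block u i)) (act T u E q).
Proof. by []. Qed.

Lemma act_walk T u E q : {in E, forall i, sqwalk (w i) (T i) (u i)} ->
  pwalk (blocks base E ++ q) (act T u E q) (blocks u E ++ q).
Proof.
elim: E => [//|i E IH] tu; rewrite !blocks_cons act_cons -!catA.
apply: (@sqwalk_cat prod_complex _ _ _ (block u i ++ blocks base E ++ q)).
  exact: (lift_walk [:: Mark i] _ (tu i (mem_head i E))).
by apply: shift_walk; apply: IH => j jE; apply: tu; rewrite inE jE orbT.
Qed.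

Lemma act_hom T T' u E q : {in E, forall i, sqwalk (w i) (T i) (u i)} ->
  {in E, forall i, sqwalk (w i) (T' i) (u i)} ->
  {in E, forall i, sqhom (w i) (u i) (T i) (T' i)} ->
  phom (blocks base E ++ q) (blocks u E ++ q) (act T u E q) (act T' u E q).
Proof.
elim: E => [|i E IH] tu tu' tt'; first exact: sqhom_refl.
have iE := mem_head i E.
have sub (P : I -> Prop) : {in i :: E, forall j, P j} -> {in E, forall j, P j}.
  by move=> H j jE; apply: H; rewrite inE jE orbT.
rewrite !blocks_cons !act_cons -!catA.
apply: (@sqhom_trans prod_complex _ _
    (map (lift [:: Mark i] (blocks base E ++ q)) (T' i) ++
     map (pshift (block u i)) (act T u E q))).
  apply: (@sqhom_catr prod_complex _ _ _ _ (block u i ++ blocks base E ++ q)).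
    exact: (shift_walk prod_path _ (act_walk _ (sub _ tu))).
  exact: (lift_hom [:: Mark i] _ (tt' i iE)).
apply: sqhom_catl (lift_walk [:: Mark i] _ (tu' i iE)) _.
exact: (shift_hom prod_path _ (IH (sub _ tu) (sub _ tu') (sub _ tt'))).
Qed.

Lemma act_nil T u E q : {in E, forall i, T i = [::]} -> act T u E q = [::].
Proof.
elim: E => //= i E IH t0; rewrite t0 ?mem_head // IH // => j jE.
by apply: t0; rewrite inE jE orbT.
Qed.

Lemma eq_act T T' u u' E q : {in E, forall i, T i = T' i} ->
  {in E, forall i, u i = u' i} -> act T u E q = act T' u' E q.
Proof.
elim: E => //= i E IH tt uu; rewrite tt ?mem_head // /block uu ?mem_head //.
by rewrite IH // => j jE; [apply: tt|apply: uu]; rewrite inE jE orbT.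
Qed.

Lemma act_inactive i T u E q : i \notin E -> all (inactive i) (act T u E q).
Proof.
elim: E => //= j E IH; rewrite inE negb_or => /andP[ij /IH {}IH].
rewrite all_cat !all_map; apply/andP; split; last exact: sub_all IH.
by elim: (T j) => //= e s ->; rewrite /inactive /= eq_sym ij.
Qed.

Lemma pproj_act i T u E q : uniq E -> {in E, forall j, wproj j q = [::]} ->
  pproj i (act T u E q) = if i \in E then T i else [::].
Proof.
elim: E => //= j E IH /andP[jE uE] q0; rewrite pproj_cat inE.
have {}IH : pproj i (act T u E q) = if i \in E then T i else [::].
  by apply: IH => // k kE; apply: q0; rewrite inE kE orbT.
have [->|ij] /= := eqVneq i j.
  rewrite pproj_lift //; last by rewrite wproj_cat wproj_blocks0 // q0 ?mem_head.
  rewrite pproj_inactive ?cats0 // all_map; exact: sub_all (act_inactive _ _ _ jE).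
by rewrite pproj_lift_neq 1?eq_sym // pproj_shift ?IH // wproj_block_neq // eq_sym.
Qed.

Lemma map_shift_cat p r s :
  map (pshift p) (map (pshift r) s) = map (pshift (p ++ r)) s.
Proof. by rewrite -map_comp; apply: eq_map => e; apply: shift_cat. Qed.

Lemma shift_lift p q r i (e : sq_edge (K i)) :
  pshift p (lift q r e) = lift (p ++ q) r e.
Proof. by apply: sq_edge_eq => /=; rewrite ?cats0 ?catA. Qed.

Lemma block_source u i (e : sq_edge (K i)) : u i = sq_source e ->
  block u i = (Mark i :: map (@arr i) (sqe_left e)) ++
    prod_top (inner (sqe_cell e)) ++ map (@arr i) (sqe_right e).
Proof. by rewrite /block => -> /=; rewrite !map_cat. Qed.

Lemma block_target u i (e : sq_edge (K i)) : u i = sq_target e ->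
  block u i = (Mark i :: map (@arr i) (sqe_left e)) ++
    prod_bot (inner (sqe_cell e)) ++ map (@arr i) (sqe_right e).
Proof. by rewrite /block => -> /=; rewrite !map_cat bot_inner. Qed.

(** On the left [e] comes last; on the right it comes just after [T i], before the runs in the
    blocks of [E2]. Those runs take place to the right of the factor rewritten by [e], hence commute
    with it. The blocks of [E1] are peeled off by induction. *)
Lemma act_rcons T T' u u' E1 i E2 q (e : sq_edge (K i)) :
  uniq (E1 ++ i :: E2) ->
  {in E1 ++ i :: E2, forall j, sqwalk (w j) (T j) (u j)} ->
  u i = sq_source e -> u' i = sq_target e -> T' i = rcons (T i) e ->
  (forall j, j != i -> u' j = u j) -> (forall j, j != i -> T' j = T j) ->
  phom (blocks base (E1 ++ i :: E2) ++ q) (blocks u' (E1 ++ i :: E2) ++ q)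
    (rcons (act T u (E1 ++ i :: E2) q)
       (lift (blocks u E1 ++ [:: Mark i]) (blocks u E2 ++ q) e))
    (act T' u' (E1 ++ i :: E2) q).
Proof.
move=> uE tu ui ui' tti uu tt.
elim: E1 uE tu => [|j E1 IH].
  rewrite -[[::] ++ i :: E2]/(i :: E2) => uE tu.
  have /andP[iE _] := uE.
  have nE2 j : j \in E2 -> j != i by apply: contraTneq => ->.
  have aE : act T' u' E2 q = act T u E2 q.
    by apply: eq_act => j jE; [apply: tt|apply: uu]; apply: nE2.
  rewrite !act_cons aE tti map_rcons cat_rcons rcons_cat.
  have wi : sqwalk (w i) (T i) (u i) by apply: tu; rewrite mem_head.
  rewrite !blocks_cons -!catA.
  apply: sqhom_catl (lift_walk [:: Mark i] _ wi) _.
  have w2 : pwalk (blocks base E2 ++ q) (act T u E2 q) (blocks u E2 ++ q).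
    by apply: act_walk => j jE; apply: tu; rewrite inE jE orbT.
  (* The walk past which [e] moves is the run in the blocks of [E2], shifted by the rest of the
     block of [i] to the right of the rewritten factor. *)
  have := @sqhom_comm _ prod_path (Mark i :: map (@arr i) (sqe_left e))
    (inner (sqe_cell e)) _ _ _
    (shift_walk prod_path (map (@arr i) (sqe_right e)) w2).
  have bE : blocks u' E2 = blocks u E2 by apply: eq_blocks => j /nE2/uu.
  rewrite -[[:: Mark i] ++ map _ (u i) ++ _]/(block u i ++ blocks base E2 ++ q).
  rewrite !map_shift_cat bE (block_source ui) (block_target ui') -!catA => H.
  exact: sqhom_sym.
rewrite -[(j :: E1) ++ i :: E2]/(j :: (E1 ++ i :: E2)) cons_uniq.
case/andP=> iE uE tu.
have ij : j != i by apply: contraNneq iE => ->; rewrite mem_cat mem_head orbT.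
have tj : sqwalk (w j) (T j) (u j) by apply: tu; rewrite mem_head.
have {}tu : {in E1 ++ i :: E2, forall j, sqwalk (w j) (T j) (u j)}.
  by move=> k kE; apply: tu; rewrite inE kE orbT.
have := shift_hom prod_path (block u j) (IH uE tu).
rewrite map_rcons shift_lift catA => {}IH.
rewrite !blocks_cons !act_cons /block uu // tt // -/(block u j) -!catA rcons_cat.
have := sqhom_catl (lift_walk [:: Mark j] _ tj) IH.
by rewrite -(catA _ (blocks u E1)).
Qed.

(** * Reading the words reachable from [Tail 0] *)

Definition is_arr (l : letter) := if l is Arr _ then true else false.
Definition is_tail (l : letter) := if l is Tail _ then true else false.

Lemma all_arr i (s : word i) : all is_arr (map (@arr i) s).
Proof. by elim: s. Qed.

Lemma blocks_no_tail u E : all (predC is_tail) (blocks u E).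
Proof.
elim: E => [//|i E IH]; rewrite blocks_cons all_cat IH andbT /=.
by elim: (u i).
Qed.

(** A nonempty factor made of arrows contains no marker and no tail, so it lies inside one block; as
    its letters carry the tag [i], this is the block of [i]. *)
Lemma parse_inner u E n i (f : word i) p q : f <> [::] ->
  blocks u E ++ [:: Tail n] = p ++ map (@arr i) f ++ q ->
  exists E1 E2 (p' q' : word i), [/\ E = E1 ++ i :: E2, u i = p' ++ f ++ q',
    p = blocks u E1 ++ Mark i :: map (@arr i) p' &
    q = map (@arr i) q' ++ blocks u E2 ++ [:: Tail n]].
Proof.
move=> f0.
have f0' : map (@arr i) f <> [::] by case: (f) f0.
elim: E p => [|j E IH] p.
  case: p => [|l p] /=; first by case: (f) f0.
  by case=> _; case: p => //; case: (f) f0.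
case: p => [|l p]; first by case: (f) f0.
rewrite blocks_cons -catA /block !cat_cons => -[<-].
(* The letter after the block of [j] is the next marker or the tail, so the factor lies either
   within this block or beyond it. *)
have [x [r [Er nx]]] : exists x r, blocks u E ++ [:: Tail n] = x :: r /\ ~~ is_arr x.
  by case: (E) => [|k E']; [exists (Tail n) | exists (Mark k)]; eexists; split.
rewrite Er => /(cat_factor (all_arr (u j)) (all_arr f) f0' nx) [][p' Ep Eq].
  move: Er; rewrite Eq => /(IH (x :: p')) [E1 [E2 [p1 [q1 [-> Eu Ep' Eq']]]]].
  exists (j :: E1), E2, p1, q1; split=> //.
  by rewrite Ep Ep' blocks_cons -catA.
have [s1 [s2 [Es Es1 /map_eq_cat[s3 [s4 [Es2 Es3 Es4]]]]]] := map_eq_cat Ep.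
have ji : j = i.
  by case: (f) f0 Es3 => // a f' _; case: (s3) => // b s' [].
clear IH; case: _ / ji in f f0 f0' Es3 Ep Eq *.
exists [::], E, s1, s4; split=> //.
- by rewrite Es Es2 (inj_map (@arr_inj j) Es3).
- by rewrite /= Es1.
- by rewrite Er Es4 Eq.
Qed.


Lemma wproj_base i : wproj i [:: Tail 0] = base i.
Proof. by rewrite wproj_cons cats0. Qed.

Lemma on_path_base i : on_path i [:: Tail 0].
Proof. by rewrite /on_path wproj_base; apply: sqv_1path. Qed.

Lemma map_shift0 s : map (pshift [::]) s = s.
Proof. by rewrite -[RHS]map_id; apply: eq_map => e; apply: shift0. Qed.

Definition wprojs (x : seq letter) i : word i := wproj i x.

Definition pprojs s i : seq (sq_edge (K i)) := pproj i s.

Lemma wproj_tail_lt i n : pickle i < n -> wproj i [:: Tail n] = [::].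
Proof. by rewrite wproj_cons /= cats0 ltnNge => /negPf ->. Qed.

Lemma wproj_vertex u n i : n <= pickle i ->
  wproj i (blocks u (idx 0 n) ++ [:: Tail n]) = base i.
Proof.
move=> ni; rewrite wproj_cat wproj_blocks0; last by rewrite mem_idx /= -leqNgt.
by rewrite wproj_cons /= ni cats0.
Qed.

Lemma walk_projandwich i p q (x : word i) :
  wproj i p = [::] -> wproj i q = [::] -> wproj i (p ++ map (@arr i) x ++ q) = x.
Proof. by rewrite !wproj_cat wproj_arr => -> ->; rewrite cats0. Qed.

(** If some index has code [m], both words end with its marker followed by arrows only, so the parts
    before that marker agree. Otherwise nothing is removed on either side. *)
Lemma parse_fold u m p : blocks u (idx 0 m.+1) = p ++ blocks base (idx m 1) ->
  blocks u (idx 0 m) = p.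
Proof.
rewrite idxSr blocks_cat add0n /idx /=; case: pickle_inv => [i|] /=.
  rewrite /blocks /= !cats0 => /(cat_pivotr (P := is_arr)) [] //; exact: all_arr.
by rewrite !cats0.
Qed.

(* Any path [s] from [Tail 0] can be completed by unfolding its last letter so
   as to become homotopic to: unfold enough letters first, then run the
   projection of [s] to each [K i] inside the block of [i]. *)
Lemma normal_form s v : pwalk [:: Tail 0] s v -> exists n N,
  [/\ v = blocks (wprojs v) (idx 0 n) ++ [:: Tail n], n <= N &
   forall k, N <= n + k ->
   phom [:: Tail 0] (blocks (wprojs v) (idx 0 (n + k)) ++ [:: Tail (n + k)])
     (s ++ map (pshift (blocks (wprojs v) (idx 0 n))) (unfolds n k))
     (unfolds 0 (n + k) ++
        act (pprojs s) (wprojs v) (idx 0 (n + k)) [:: Tail (n + k)])].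
Proof.
elim/last_ind: s v => [|s e IH] v.
  move=> /= <-; exists 0, 0; split=> // k _.
  rewrite act_nil // map_shift0 cats0; exact: sqhom_refl.
move=> wse; have /walk_cat[z ws [ez ev]] : pwalk [:: Tail 0] (s ++ [:: e]) v.
  by rewrite cats1.
have {}ez : sq_source e = z :> seq letter := ez.
have {}ev : sq_target e = v :> seq letter := ev.
have {IH} [n [N [Ez nN IH]]] := IH _ ws.
(* Indices of code at least [n] are still hidden in the tail, which projects to [base]. *)
have u_base i : n <= pickle i -> wprojs z i = base i.
  by move=> ni; rewrite /wprojs Ez wproj_vertex.
have uE k : blocks (wprojs z) (idx n k) = blocks base (idx n k).
  by apply: eq_blocks => i; rewrite mem_idx => /andP[ni _]; apply: u_base.
have walk_proj i : sqwalk (w i) (pproj i s) (wprojs z i).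
  by have := pproj_walk (on_path_base i) ws; rewrite wproj_base.
case Ee : (sqe_cell e : prod_cell) => [[i g]|b m].
  (* First case: [e] rewrites inside the block of [i] and is the lift of an edge [d] of the Squier
     complex of [K i]. *)
  have Ez' := Ez; rewrite -{1}ez /= in Ez'.
  have [E1 [E2 [p' [q' [Eidx Eu Ep Eq]]]]] : exists E1 E2 (p' q' : word i),
    [/\ idx 0 n = E1 ++ i :: E2, wprojs z i = p' ++ top g ++ q',
    sqe_left e = blocks (wprojs z) E1 ++ Mark i :: map (@arr i) p' &
    sqe_right e = map (@arr i) q' ++ blocks (wprojs z) E2 ++ [:: Tail n]].
    apply: parse_inner; first exact: top_neq0.
    by rewrite -Ez' Ee.
  have H : is_1path (p' ++ top g ++ q').
    rewrite -Eu.
    by have [] := functor_walk (@on_path_step i) (@eproj_walk i) (on_path_base i) ws.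
  pose d := SqEdge H.
  have Ed : e = lift (blocks (wprojs z) E1 ++ [:: Mark i])
      (blocks (wprojs z) E2 ++ [:: Tail n]) d.
    by apply: sq_edge_eq; rewrite /= ?Ep ?Eq -?catA.
  have Eupd : uniq (E1 ++ i :: E2) by rewrite -Eidx idx_uniq.
  have [iE1 iE2] : i \notin E1 /\ i \notin E2.
    move: Eupd; rewrite cat_uniq /= negb_or => /and3P[_ /andP[-> _] /andP[-> _]].
    by [].
  have ilt : pickle i < n.
    by have := mem_idx 0 n i; rewrite Eidx mem_cat mem_head orbT add0n => /esym.
  have P0 : wproj i (blocks (wprojs z) E1 ++ [:: Mark i]) = [::].
    by rewrite wproj_cat wproj_blocks0.
  have Q0 : wproj i (blocks (wprojs z) E2 ++ [:: Tail n]) = [::].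
    by rewrite wproj_cat wproj_blocks0 // wproj_tail_lt.
  have v_i : wprojs v i = sq_target d.
    by rewrite /wprojs -ev Ed lift_target walk_projandwich.
  have z_i : wprojs z i = sq_source d by [].
  have v_j j : j != i -> wprojs v j = wprojs z j.
    move=> ji; rewrite /wprojs -ev -ez target_inactive // Ee /=.
    by rewrite eq_sym.
  have vE1 : blocks (wprojs v) E1 = blocks (wprojs z) E1.
    by apply: eq_blocks => j jE; apply: v_j; apply: contraNneq iE1 => <-.
  have vE2 : blocks (wprojs v) E2 = blocks (wprojs z) E2.
    by apply: eq_blocks => j jE; apply: v_j; apply: contraNneq iE2 => <-.
  have vB : blocks (wprojs v) (idx 0 n) =
      (blocks (wprojs z) E1 ++ Mark i :: map (@arr i) p') ++ prod_bot (inner g) ++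
      map (@arr i) q' ++ blocks (wprojs z) E2.
    by rewrite Eidx blocks_cat blocks_cons (block_target v_i) vE1 vE2 /= -!catA.
  have zB : blocks (wprojs z) (idx 0 n) =
      (blocks (wprojs z) E1 ++ Mark i :: map (@arr i) p') ++ prod_top (inner g) ++
      map (@arr i) q' ++ blocks (wprojs z) E2.
    by rewrite Eidx blocks_cat blocks_cons (block_source z_i) /= -!catA.
  exists n, N; split=> //.
    by rewrite vB -ev /= Ep Eq Ee -!catA.
  move=> k /IH{}IH.
  have Eidx' : idx 0 (n + k) = E1 ++ i :: (E2 ++ idx n k).
    by rewrite idx_cat Eidx add0n -catA.
  have := shift_walk prod_path (map (@arr i) q' ++ blocks (wprojs z) E2)
    (unfolds_walk n k).
  rewrite -!catA => wX.
  pose p := blocks (wprojs z) E1 ++ Mark i :: map (@arr i) p'.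
  rewrite -/p in vB zB Ep.
  pose f : cell2 prod_complex := inner g.
  pose y := map (@arr i) q' ++ blocks (wprojs z) E2 ++ blocks base (idx n k) ++
    [:: Tail (n + k)].
  (* The completing unfoldings happen to the right of [e], so [e] can be performed after them;
     [act_rcons] then absorbs it into the run in the block of [i]. *)
  have := sqhom_comm prod_path p f wX; rewrite -/y.
  rewrite !map_shift_cat -!(catA p) -zB -vB.
  set x := map _ q' ++ blocks _ E2 ++ _.
  have <- : e = pedge p f x by apply: sq_edge_eq; rewrite /= ?Ep ?Eq ?Ee.
  have zp : p ++ top f ++ x = z by rewrite -ez /= Ep Eq Ee.
  have zy : p ++ top f ++ y = blocks (wprojs z) (idx 0 (n + k)) ++ [:: Tail (n + k)].
    by rewrite idx_cat blocks_cat zB add0n uE /y -!catA.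
  have vy : p ++ bot f ++ y = blocks (wprojs v) (idx 0 (n + k)) ++ [:: Tail (n + k)].
    rewrite idx_cat blocks_cat vB add0n /y -!catA; do 5!congr (_ ++ _).
    rewrite -uE; congr (_ ++ _); apply: eq_blocks => j; rewrite mem_idx => /andP[nj _].
    by apply/esym/v_j; apply: contraTneq nj => ->; rewrite -ltnNge.
  rewrite zp vy => comm; rewrite cat_rcons.
  apply: sqhom_trans (sqhom_catl ws comm) _.
  have wF : pwalk (blocks (wprojs z) (idx 0 (n + k)) ++ [:: Tail (n + k)])
      [:: pedge p f y] (blocks (wprojs v) (idx 0 (n + k)) ++ [:: Tail (n + k)]).
    by rewrite -zy -vy.
  rewrite -rcons_cat -cats1; apply: sqhom_trans (sqhom_catr wF IH) _.
  rewrite -catA (cats1 (act _ _ _ _)); apply: sqhom_catl (unfolds_walk 0 (n + k)) _.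
  rewrite add0n.
  have -> : pedge p f y = lift (blocks (wprojs z) E1 ++ [:: Mark i])
      (blocks (wprojs z) (E2 ++ idx n k) ++ [:: Tail (n + k)]) d.
    by apply: sq_edge_eq; rewrite /= ?blocks_cat ?uE /p /y -?catA.
  rewrite Eidx'; apply: act_rcons => //.
  - by rewrite -Eidx' idx_uniq.
  - by rewrite /pprojs pproj_rcons Ed eproj_lift // cats1.
  - by move=> j ji; rewrite /pprojs pproj_rcons eproj_inactive ?cats0 // Ee /= eq_sym.
(* The remaining cells, unfolds and folds, change no projection. *)
have u_v : wprojs v = wprojs z.
  apply: functional_extensionality_dep => i; rewrite /wprojs -ev -ez.
  by rewrite target_inactive // Ee.
have pproj_s : pprojs (rcons s e) = pprojs s.
  apply: functional_extensionality_dep => i.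
  by rewrite /pprojs pproj_rcons eproj_inactive ?cats0 // Ee.
rewrite u_v pproj_s.
case: b Ee => Ee.
  have [Ep Em Eq] : [/\ blocks (wprojs z) (idx 0 n) = sqe_left e, Tail n = Tail m &
      sqe_right e = [::]].
    apply: (cat_pivot_last (P := predC is_tail)) => //; first exact: blocks_no_tail.
    by rewrite -Ez -ez /= Ee.
  case: Em Ee => <- {m} Ee.
  (* Completing by [k] letters after unfolding [Tail n] is completing by [k.+1] letters before it.
     The maximum maintains the inequality between the two witnesses, on which the case of a fold
     relies. *)
  exists n.+1, (maxn N n.+1); rewrite leq_maxr; split=> //.
    rewrite -ev /= Ee Eq cats0 -Ep idxSr blocks_cat add0n uE -catA.
    by [].
  move=> k; rewrite geq_max => /andP[Nk _].
  have := IH k.+1; rewrite addnS -addSn => /(_ Nk) /=.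
  rewrite map_shift_cat (idxSr 0 n) blocks_cat add0n uE.
  have -> : pshift (blocks (wprojs z) (idx 0 n)) (unfold n) = e.
    by apply: sq_edge_eq; rewrite /= ?Eq ?cats0 ?Ee ?Ep.
  by rewrite cat_rcons.
have [Ep Em Eq] : [/\ blocks (wprojs z) (idx 0 n) = sqe_left e ++ blocks base (idx m 1),
    Tail n = Tail m.+1 & sqe_right e = [::]].
  apply: (cat_pivot_last (P := predC is_tail)) => //; first exact: blocks_no_tail.
  by rewrite -Ez -ez /= Ee /= /unfolding -!catA.
(* Here [e] folds the last block, so [n = m.+1]. *)
case: Em => Em; rewrite {}Em in Ez nN IH u_base uE Ep *.
have {}Ep' := parse_fold Ep.
exists m, N; split; [|exact: ltnW|].
  by rewrite -ev /= Ee Eq Ep'.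
(* Since [m.+1 <= N], the completion cannot be empty: it starts by unfolding [Tail m], which cancels
   the fold [e]. *)
case=> [|k] Nk; first by rewrite addn0 leqNgt nN in Nk.
rewrite cat_rcons.
have := IH k; rewrite addSn -addnS => /(_ Nk); apply: sqhom_trans.
apply: sqhom_catl ws _; rewrite /= map_shift_cat.
have <- : sq_inv e = pshift (blocks (wprojs z) (idx 0 m)) (unfold m).
  by apply: sq_edge_eq; rewrite /= ?Eq ?Ee ?Ep' ?cats0.
rewrite Ep' -Ep.
have wU := shift_walk prod_path (blocks (wprojs z) (idx 0 m.+1)) (unfolds_walk m.+1 k).
have := sqhom_inv e; rewrite -Ez ez in wU * => H.
have := sqhom_catr wU H; rewrite -uE catA -blocks_cat.
have -> : idx 0 m.+1 ++ idx m.+1 k = idx 0 (m + k.+1).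
  by rewrite -idx_cat addSnnS.
by rewrite addSnnS.
Qed.

(** * The isomorphism with the restricted product *)

Lemma tail_neq0 n : [:: Tail n] <> [::].
Proof. by []. Qed.

Definition prod_base : sq_vertex prod_complex :=
  @SqVertex prod_complex [:: Tail 0] (@tail_neq0 0) (prod_path [:: Tail 0]).

Lemma pproj_loop_subproof i (l : @loop (Sq prod_complex) prod_base) :
  @walk (Sq (K i)) (w i) (pproj i l) (w i).
Proof.
have /sqwalkP wl := loopP l; apply/sqwalkP.
by have := pproj_walk (on_path_base i) wl; rewrite wproj_base.
Qed.

Definition pproj_loop i (l : @loop (Sq prod_complex) prod_base) :
  @loop (Sq (K i)) (w i) := Loop (pproj_loop_subproof i l).

Lemma pproj_loop_homotopic i (l l' : @loop (Sq prod_complex) prod_base) :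
  homotopic l l' -> homotopic (pproj_loop i l) (pproj_loop i l').
Proof.
move=> /sqhom_homotopic/(pproj_hom (on_path_base i)); rewrite wproj_base.
by move=> ?; apply/sqhom_homotopic.
Qed.

Definition coord i (a : Dgroup prod_base) : Dgroup (w i) :=
  \pi_(pi1 (w i : vertex (Sq (K i)))) (pproj_loop i (repr a)).

Lemma coordE i (l : @loop (Sq prod_complex) prod_base) :
  coord i (\pi_(pi1 (prod_base : vertex (Sq prod_complex))) l) =
  \pi_(pi1 (w i : vertex (Sq (K i)))) (pproj_loop i l).
Proof. by apply/pi1P/pproj_loop_homotopic/pi1P; rewrite reprK. Qed.

Lemma coordM i (a b : Dgroup prod_base) : coord i (a * b) = coord i a * coord i b.
Proof.
rewrite [a * b]/(pi1_mul a b) /pi1_mul coordE [RHS]pi1_mulE.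
by congr (\pi_ _ _); apply: loop_inj; rewrite /= pproj_cat.
Qed.

(** A loop has finitely many edges, and its projection to [K i] is empty unless a cell of [K i]
    occurs in one of them. *)
Lemma coord_support (a : Dgroup prod_base) : fin_supp (fun i => coord i a).
Proof.
apply/asboolP.
pose cells : seq I := pmap (fun e : sq_edge prod_complex =>
  if (sqe_cell e : prod_cell) is Inner c then Some (tag c) else None) (repr a).
apply: (sub_finite_set _ (finite_seq cells)) => i /= Hi.
apply: contrapT => /negP ni; apply: Hi; congr (\pi_ _ _); apply: loop_inj => /=.
apply: pproj_inactive; move: ni; rewrite /cells.
elim: (loop_seq _) => //= e s IH.
rewrite /inactive /active; case: (sqe_cell e : prod_cell) => //= c.
by rewrite inE negb_or eq_sym => /andP[-> /IH].
Qed.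

Definition coords (a : Dgroup prod_base) :
    restricted_prod (fun i => Dgroup (w i)) :=
  RestrictedProd (coord_support a).

Lemma coordsM : {morph coords : a b / a * b}.
Proof. by move=> a b; apply: rp_eq => i; apply: coordM. Qed.

(** Let [U] unfold enough letters. By the normal form, the loop followed by [U] is homotopic to [U]
    followed by the runs of its projections in the blocks. These are null-homotopic, so the runs
    contract and cancelling [U] contracts the loop. *)
Lemma coord_trivial (a : Dgroup prod_base) : (forall i, coord i a = 1) -> a = 1.
Proof.
move=> a1; rewrite -[a]reprK; apply/pi1P/sqhom_homotopic => /=.
have /sqwalkP wl := loopP (repr a); set l := loop_seq (repr a) in wl *.
have [n [N [E _ H]]] := normal_form wl.
(* The end word is the single letter [Tail 0], so no block is present. *)
have n0 : n = 0.
  by have := cat_pivot_last (P := predC is_tail) (y := Tail 0) isT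
    (blocks_no_tail _ _) (esym E : _ = [::] ++ [:: Tail 0]); case=> _ [].
have pb : wprojs [:: Tail 0] = base.
  by apply: functional_extensionality_dep => i; apply: wproj_base.
have := H N; rewrite {}n0 add0n pb map_shift0 => /(_ (leqnn N)) {}H.
have U := unfolds_walk 0 N; rewrite add0n in U.
have walk_proj i : sqwalk (w i) (pprojs l i) (base i).
  by have := pproj_walk (on_path_base i) wl; rewrite wproj_base.
have Phi0 i : sqhom (w i) (base i) (pprojs l i) [::].
  by have /pi1P/sqhom_homotopic := a1 i.
have A := @act_hom (pprojs l) (fun=> [::]) base (idx 0 N) [:: Tail N]
  (fun i _ => walk_proj i) (fun i _ => erefl) (fun i _ => Phi0 i).
rewrite (act_nil (T := fun=> [::])) // in A.
have {A}H := sqhom_trans H (sqhom_catl U A); rewrite cats0 in H.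
have V := sqwalk_rev U; have {}H := sqhom_catr V H; rewrite -catA in H.
have C := sqhom_cancel U; apply: sqhom_trans (sqhom_trans H C).
by apply: sqhom_sym; have := sqhom_catl wl C; rewrite cats0.
Qed.

(** Unfold until the whole support is covered, run a representative of each coordinate in its block,
    and fold back; folding is possible because the representatives are loops at [w i]. *)
Lemma coords_surj (g : restricted_prod (fun i => Dgroup (w i))) :
  exists a, coords a = g.
Proof.
have /asboolP /finite_seqP[S ES] := rp_fin g.
(* The successor makes every code in the support strictly less than [N]. *)
pose N := (\max_(i <- S) pickle i).+1.
have gN i : N <= pickle i -> g i = 1.
  move=> Ni; apply: contrapT => gi.
  have iS : i \in S by have : [set` S]%classic i by rewrite -ES.
  by move: Ni; rewrite leqNgt ltnS leq_bigmax_seq.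
pose T i : seq (sq_edge (K i)) := repr (g i : pi1 (w i : vertex (Sq (K i)))).
have wT i : sqwalk (w i) (T i) (base i).
  by have /sqwalkP := loopP (repr (g i : pi1 (w i : vertex (Sq (K i))))).
pose s := unfolds 0 N ++ act T base (idx 0 N) [:: Tail N] ++ sqrev (unfolds 0 N).
have U := unfolds_walk 0 N; rewrite add0n in U.
have ws : @walk (Sq prod_complex) prod_base s prod_base.
  apply/sqwalkP; apply: (sqwalk_cat U); apply: sqwalk_cat (sqwalk_rev U).
  by apply: act_walk => i _.
exists (\pi_(pi1 (prod_base : vertex (Sq prod_complex))) (Loop ws)).
apply: rp_eq => i; rewrite /= coordE.
have E : loop_seq (pproj_loop i (Loop ws)) = if pickle i < N then T i else [::].
  rewrite /= !pproj_cat pproj_unfolds pproj_unfolds_rev cats0 pproj_act ?idx_uniq //.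
    by rewrite mem_idx add0n.
  by move=> j; rewrite mem_idx add0n => /andP[_ /wproj_tail_lt].
case: ltnP E => [_|/gN ->] E.
  by rewrite -[RHS]reprK; congr (\pi_ _ _); apply: loop_inj; rewrite E.
by congr (\pi_ _ _); apply: loop_inj; rewrite E.
Qed.

End ProductComplex.

(** * Isomorphisms *)

Lemma isomorphic_of (G H : groupType) (f : G -> H) :
  {morph f : x y / x * y} -> injective f -> (forall y, exists x, f x = y) ->
  isomorphic G H.
Proof.
move=> fM f_inj f_surj; pose F := isMultiplicative.Build G H f fM.
pose f' : {multiplicative G -> H} := HB.pack f F.
exists f'; exists (fun y => projT1 (cid (f_surj y))) => [x|y].
  by case: cid => x' /= /f_inj.
by case: cid.
Qed.

Lemma isomorphic_sym (G H : groupType) : isomorphic G H -> isomorphic H G.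
Proof.
case=> f [g fK gK]; apply: (@isomorphic_of _ _ g) => [x y|x y E|x].
- by apply: (can_inj fK); rewrite gmulfM !gK.
- by rewrite -[x]gK E gK.
- by exists (f x).
Qed.

Lemma isomorphic_trans (G H L : groupType) :
  isomorphic G H -> isomorphic H L -> isomorphic G L.
Proof.
by case=> f bf [g bg]; exists (g \o f : {multiplicative G -> L}); apply: bij_comp.
Qed.

Lemma isomorphic_restricted_prod (I : Type) (G H : I -> groupType) :
  (forall i, isomorphic (G i) (H i)) ->
  isomorphic (restricted_prod G) (restricted_prod H).
Proof.
move=> GH; pose f i := projT1 (cid (GH i)).
have f_bij i : bijective (f i) by apply: projT2 (cid (GH i)).
have f1 i : f i 1 = 1 by apply: (mulIg (f i 1)); rewrite -gmulfM !mul1g.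
have f_fin (u : restricted_prod G) : fin_supp (fun i => f i (u i)).
  have /asboolP fu := rp_fin u; apply/asboolP.
  apply: sub_finite_set fu => i /= fi ui.
  by apply: fi; rewrite ui f1.
apply: (@isomorphic_of _ _ (fun u => RestrictedProd (f_fin u))) => [u v|u v E|v].
- by apply: rp_eq => i; apply: gmulfM.
- apply: rp_eq => i; apply: (bij_inj (f_bij i)).
  by have := congr1 (fun t => rp_val t i) E.
have f_onto i : exists x, f i x = v i by have [g _ gK] := f_bij i; exists (g (v i)).
pose u i := projT1 (cid (f_onto i)).
have uE i : f i (u i) = v i by apply: projT2 (cid (f_onto i)).
have u_fin : fin_supp u.
  have /asboolP fv := rp_fin v; apply/asboolP.
  apply: sub_finite_set fv => i /= ui vi.
  by apply: ui; apply: (bij_inj (f_bij i)); rewrite uE vi f1.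
by exists (RestrictedProd u_fin); apply: rp_eq => i; apply: uE.
Qed.

Theorem theorem2p5 (I : countType) (G : I -> groupType)
    (HG : forall i : I, diagram_group (G i)) :
  diagram_group (restricted_prod G).
Proof.
pose K i := projT1 (cid (HG i)).
pose w i : sq_vertex (K i) := projT1 (cid (projT2 (cid (HG i)))).
have iso i : isomorphic (G i) (Dgroup (w i)) := projT2 (cid (projT2 (cid (HG i)))).
exists (prod_complex w), (prod_base w).
apply: isomorphic_trans (isomorphic_restricted_prod iso) _.
apply: isomorphic_sym; apply: (isomorphic_of (@coordsM _ _ w)); last exact: coords_surj.
(* Injectivity reduces to triviality of the kernel, applied to the quotient of [a] by [b]; that
   [coord i] sends 1 to 1 then follows by cancelling [coord i b]. *)
move=> a b ab; apply: (mulIg b^-1); rewrite mulgV; apply: coord_trivial => i.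
have E : coord i a = coord i b by have := congr1 (fun t => rp_val t i) ab.
rewrite coordM E -coordM mulgV; apply: (mulIg (coord i b)).
by rewrite -coordM !mul1g.
Qed.
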